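(* Let $\varepsilon>0$ be real and let $n,k\ge 1$ be integers with $k<n\left(\tfrac12-\varepsilon\right)-1$. Then there exists a constant $q_\varepsilon$ such that for every odd prime power $q=p^v$ ($p$ prime) with $q\ge q_\varepsilon$ and $k<p$, and for all prescribed values $c_1,c_2,\dots,c_k\in\mathbf{F}_q$, there exists a primitive polynomial $$f(x)=x^n+c_1x^{n-1}+c_2x^{n-2}+\cdots+c_{n-1}x+c_n\in\mathbf{F}_q[x]$$ of degree $n$ whose $k$ consecutive coefficients of $x^{n-1},x^{n-2},\dots,x^{n-k}$ are the prescribed elements $c_1,\dots,c_k$.
   Context: $\mathbf{F}_q$ is the finite field with $q$ elements. A monic polynomial $f\in\mathbf{F}_q[x]$ of degree $n$ is primitive if it is irreducible over $\mathbf{F}_q$ and its roots have multiplicative order $q^n-1$, i.e. they generate the multiplicative group of $\mathbf{F}_{q^n}$. *)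

(* Defs.v *)
From HB Require Import structures.
From mathcomp Require Import all_boot all_order all_algebra all_field.

Set Implicit Arguments.
Unset Strict Implicit.
Unset Printing Implicit Defensive.

Import GRing.Theory.
Local Open Scope ring_scope.

(* The roots of f are taken in arbitrary finite extensions L of F. With N =   *)
(* q^n - 1, N.-primitive_root x says that x has multiplicative order exactly  *)
(* N. The root condition is not vacuous: an irreducible polynomial has a root *)
(* in some finite extension of F.                                             *)
Definition primitive_polynomial (F : finFieldType) (f : {poly F}) : Prop :=
  [/\ f \is monic,
      irreducible_poly f
    & forall (L : fieldExtType F) (x : L),
        root (map_poly (in_alg L) f) x ->
        ((#|F| ^ (size f).-1).-1)%N.-primitive_root x].

(* Main.v *)
Require Import Defs.
From HB Require Import structures.
From mathcomp Require Import all_boot all_order all_algebra all_field.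
From mathcomp Require Import reals.
From mathcomp Require Import ring lra zify.

Set Implicit Arguments.
Unset Strict Implicit.
Unset Printing Implicit Defensive.

Import Order.TTheory GRing.Theory Num.Theory.
Local Open Scope ring_scope.

(** Let q be the cardinality of F, Q = q^n and N = Q - 1.  If x has order N in
    the field with Q elements, its minimal polynomial over F is primitive of
    degree n, with roots x^(q^l), l < n.  As k < p, Newton's identities turn the
    prescription of c_1, ..., c_k into the prescription of the traces over F of
    x, x^2, ..., x^k.  So it is enough to find an element of order N in the set V
    of the elements with these traces.

    Let d divide N.  By orthogonality of the additive characters psi of F, the
    number of y such that y^d lies in V is Q / q^k plus 1 / q^k times a sum, over
    the nonzero a in F^k, of unimodular multiples of the sums of
    psi(Tr(f_a(y^d))), where f_a is the sum of the a_j X^j.  Each of these is at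
    most d k sqrt(Q) by Weil's bound, because f_a(X^d) has degree at most d k and
    prime to p.  A nonzero d-th power is the d-th power of exactly d elements, so
    V contains Q / (q^k d) nonzero d-th powers, up to
    k sqrt(Q) ([sifted_nil]): the error does not depend on d.  Removing the
    l-th powers for the omega prime divisors l of N, one at a time, leaves at
    least Q / (q^k 2^omega) - 2^omega k sqrt(Q) elements
    ([sifted_bound], [exists_primitive_traces]), and what is left has order N.
    This number is positive because 2^omega grows more slowly than any power
    of N ([exp2_omega_bound]) while the hypothesis on k gives
    q^(n - 2k) > q^(2 eps n) q^2: the first factor absorbs 16^omega, the
    second one k^2.

    Weil's bound ([weil_bound]) is needed for the sums of psi(h(y)) only, where
    h has degree D prime to p, over an arbitrary finite field, whose cardinality
    is denoted by q from now on.  Give a monic polynomial g the weight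
    psi(h(x_1) + ... + h(x_m)), the x_i being its roots.  Weights are
    multiplicative, so unique factorization expresses m times the sum c_m of
    the weights of degree m in terms of the sums S_r attached to h over the
    extensions of degree r: it is the sum of the S_r c_(m - r)
    ([Lcoef_rec]).  For m >= D, adding t to the coefficient of X^(m - D) in g
    changes only the D-th power sum among the first D, by - D t, so it
    multiplies the weight by a character of t which is nontrivial as p does not
    divide D; hence c_m = 0 ([Lcoef_vanish]).  Newton's identities then give
    D - 1 complex numbers w with S_r = - sum of the w^r for all r.  It remains
    to bound each |w| by sqrt(q), and for this any bound
    |S_(2r)| <= C q^r with C independent of r is enough ([psum_bound]).

    Such a bound comes from Stepanov's method ([stepanov_bound]).  Over a field
    with s^2 elements, s a power of p, the absolute trace of h(y) has the form
    A(y) + A(y)^s with A a polynomial of degree D s / p.  Hence y^(s^2) = y and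
    A(y)^s = c - A(y) at the points y where the trace is c, and these two
    relations allow the construction of a nonzero polynomial of degree at most
    s^2 / p + O(s) vanishing at all of them.

    All finite fields are seen inside one algebraic closure K of F: the one
    with q elements is the list of the roots of X^q - X. *)

(** * Newton's identities *)

Definition psum (R : nzRingType) (s : seq R) r : R := \sum_(x <- s) x ^+ r.

(** The reciprocal of the monic polynomial with roots s, so that the i-th
    coefficient is, up to sign, the i-th elementary symmetric function, whatever
    the length of s. *)
Definition revprod (R : nzRingType) (s : seq R) : {poly R} :=
  \prod_(x <- s) (1 - x *: 'X).

(** With E = [revprod s], the power sums satisfy
    - X E' / E = sum of the p_r X^r as power series; the truncated form below,
    modulo X^(N+1), stays within polynomials. *)
Lemma newton_poly (R : comNzRingType) (s : seq R) N :
  exists H : {poly R},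
    revprod s * \sum_(1 <= r < N.+1) psum s r *: 'X^r + 'X * (revprod s)^`()
    = 'X^(N.+1) * H.
Proof.
elim: s => [|x s [H IH]].
  exists 0; rewrite /revprod big_nil derivC mulr0 addr0 mul1r mulr0.
  by apply: big1 => r _; rewrite /psum big_nil scale0r.
exists ((1 - x *: 'X) * H - x ^+ N.+1 *: revprod s).
have -> : revprod (x :: s) = (1 - x *: 'X) * revprod s by rewrite /revprod big_cons.
have -> : \sum_(1 <= r < N.+1) psum (x :: s) r *: 'X^r =
  \sum_(1 <= r < N.+1) x ^+ r *: 'X^r + \sum_(1 <= r < N.+1) psum s r *: 'X^r.
  rewrite -big_split; apply: eq_bigr => r _ /=.
  by rewrite -scalerDl /psum big_cons.
rewrite derivM derivB derivC derivZ derivX sub0r.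
have geo : (1 - x *: 'X) * \sum_(1 <= r < N.+1) x ^+ r *: 'X^r =
           x *: 'X - x ^+ N.+1 *: 'X^(N.+1).
  rewrite mulr_sumr.
  under eq_bigr => r _.
    rewrite mulrBl mul1r -scalerAl -scalerAr scalerA -!exprS.
    over.
  rewrite (@telescope_sumr_eq _ _ _ (fun r => - (x ^+ r *: 'X^r))) //.
    by rewrite opprK addrC expr1.
  by move=> i _; rewrite opprK addrC.
transitivity (((1 - x *: 'X) * \sum_(1 <= r < N.+1) x ^+ r *: 'X^r) * revprod s
  + (1 - x *: 'X) * (revprod s * (\sum_(1 <= r < N.+1) psum s r *: 'X^r)
      + 'X * (revprod s)^`()) - 'X * (x *: 1) * revprod s); first by ring.
rewrite geo IH -!mul_polyC; ring.
Qed.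

Lemma newton (R : comNzRingType) (s : seq R) j :
  j%:R * (revprod s)`_j =
  - \sum_(1 <= r < j.+1) psum s r * (revprod s)`_(j - r).
Proof.
have [H /(congr1 (fun P : {poly R} => P`_j))] := newton_poly s j.
rewrite coefD coefXM coefXnM ltnSn coef_deriv.
have -> : (if j == 0%N then 0 else (revprod s)`_j.-1.+1 *+ j.-1.+1) =
  j%:R * (revprod s)`_j by case: j => [|j]; rewrite ?mul0r // mulr_natl.
rewrite mulr_sumr coef_sum => /eqP; rewrite addrC addr_eq0 => /eqP->.
congr (- _); apply: eq_big_nat => r /andP[_ rj].
by rewrite -scalerAr coefZ coefMXn ltnNge -ltnS rj.
Qed.

Lemma revprod0 (R : comNzRingType) (s : seq R) : (revprod s)`_0 = 1.
Proof.
rewrite -horner_coef0 /revprod horner_prod big1 // => x _.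
by rewrite !hornerE subr0.
Qed.

Lemma coef_revprod_cons (R : comNzRingType) x (s : seq R) i :
  (revprod (x :: s))`_i.+1 = (revprod s)`_i.+1 - x * (revprod s)`_i.
Proof.
by rewrite /revprod big_cons mulrBl mul1r -scalerAl coefB coefZ coefXM.
Qed.

Lemma size_revprod (R : comNzRingType) (s : seq R) :
  (size (revprod s) <= (size s).+1)%N.
Proof.
elim: s => [|y s IH]; first by rewrite /revprod big_nil size_poly1.
rewrite /revprod big_cons -/(revprod s) (leq_trans (size_polyMleq _ _)) //=.
have : (size (1 - y *: 'X : {poly R})%R <= 2)%N.
  rewrite (leq_trans (size_polyD _ _)) // geq_max size_poly1 size_polyN /=.
  by rewrite (leq_trans (size_scale_leq _ _)) // size_polyX.
by move: IH; move: (size (polyseq _)) (size (polyseq _)) => a b; lia.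
Qed.

Lemma coef_revprod (R : comNzRingType) (s : seq R) i : (i <= size s)%N ->
  (\prod_(x <- s) ('X - x%:P))`_(size s - i) = (revprod s)`_i.
Proof.
elim: s i => [|x s IH] [|i] //=.
- by rewrite /revprod !big_nil.
- move=> _; rewrite revprod0 subn0.
  have /monicP := monic_prod_XsubC (x :: s) predT id.
  by rewrite lead_coefE size_prod_XsubC.
rewrite ltnS => is_; rewrite coef_revprod_cons -(IH i) // big_cons mulrBl coefB.
rewrite coefXM coefCM subSS subn_eq0; congr (_ - _).
move: is_; rewrite leq_eqVlt => /predU1P[->|lt_is].
  by rewrite leqnn; apply/esym/nth_default/size_revprod.
by rewrite leqNgt lt_is /= -subnS IH.
Qed.

(** The recursion of Newton's identities determines the power sums: it is
    triangular as c_0 = 1. *)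
Lemma newton_uniq (R : nzRingType) (c u u' : nat -> R) : c 0 = 1 ->
  (forall j, \sum_(1 <= r < j.+1) u r * c (j - r)%N =
             \sum_(1 <= r < j.+1) u' r * c (j - r)%N) ->
  forall j, (0 < j)%N -> u j = u' j.
Proof.
move=> c0 E; elim/ltn_ind => j IH j0.
have := E j; rewrite !big_nat_recr //= subnn c0 !mulr1.
rewrite (eq_big_nat _ _ (F2 := fun r => u' r * c (j - r)%N)); first by move/addrI.
by move=> r /andP[r0 rj]; rewrite IH.
Qed.

(** Conversely the power sums determine the elementary symmetric functions as
    long as the integers to divide by are nonzero. *)
Lemma newton_coef_inj (R : idomainType) (s s' : seq R) k :
  (forall r, (0 < r <= k)%N -> r%:R != 0 :> R) ->
  (forall r, (0 < r <= k)%N -> psum s r = psum s' r) ->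
  forall j, (j <= k)%N -> (revprod s)`_j = (revprod s')`_j.
Proof.
move=> nz eqp; elim/ltn_ind => -[|j] IH jk; first by rewrite !revprod0.
apply: (@mulfI _ j.+1%:R); first by apply: nz.
rewrite !newton; congr (- _); apply: eq_big_nat => r /andP[r0 rj].
rewrite eqp; last by rewrite r0 (leq_trans _ jk).
by rewrite IH //; lia.
Qed.

(** In Newton's identities the D-th coefficient e_D of [revprod s] enters p_D
    through - D e_D only, and enters no earlier power sum. *)
Lemma newton_shift (R : comNzRingType) (s s' : seq R) D : (0 < D)%N ->
  (forall i, (i < D)%N -> (revprod s')`_i = (revprod s)`_i) ->
  (forall r, (0 < r < D)%N -> psum s' r = psum s r) /\
  psum s' D = psum s D - D%:R * ((revprod s')`_D - (revprod s)`_D).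
Proof.
move=> D0 eqe.
have eqp r : (0 < r < D)%N -> psum s' r = psum s r.
  move=> /andP[r0 rD]; elim/ltn_ind: r r0 rD => r IH r0 rD.
  have := newton s r; rewrite -eqe // newton => /oppr_inj.
  rewrite !big_nat_recr //= subnn !revprod0 !mulr1.
  rewrite (eq_big_nat _ _ (F2 := fun i => psum s i * (revprod s)`_(r - i))).
    by move/addrI.
  move=> i /andP[i0 ir]; rewrite IH ?eqe //; lia.
split=> //.
have := newton s D; have := newton s' D.
rewrite !big_nat_recr //= subnn !revprod0 !mulr1.
rewrite (eq_big_nat _ _ (F2 := fun i => psum s i * (revprod s)`_(D - i))).
  move=> E' E; rewrite mulrBr E E'; ring.
move=> i /andP[i0 ir]; rewrite eqp ?i0 // eqe //; lia.
Qed.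

(** * Growth of power sums *)

Lemma expr_bound_le1 (z C : algC) : 0 <= z ->
  (forall m, z ^+ m.+1 <= C) -> z <= 1.
Proof.
move=> z0 zC; rewrite real_leNgt ?ger0_real //; apply/negP => z1.
have C0 : 0 <= C by apply: le_trans (zC 0%N); rewrite exprn_ge0.
have zm1 : 0 < z - 1 by rewrite subr_gt0.
pose n := Num.bound (C / (z - 1)).
have : C / (z - 1) < n%:R by apply: archi_boundP; rewrite divr_ge0 // ltW.
rewrite ltr_pdivrMr // => Cn.
have bern m : m%:R * (z - 1) <= z ^+ m.
  elim: m => [|m IH]; first by rewrite mul0r expr0 ler01.
  rewrite -natr1 mulrDl mul1r exprS.
  have zm : 1 <= z ^+ m by rewrite exprn_ege1 // ltW.
  have -> : z * z ^+ m = z ^+ m + (z - 1) * z ^+ m by ring.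
  by rewrite lerD // ler_peMr // ltW.
have := lt_le_trans Cn (le_trans (bern n) _).
case: (n) Cn => [|n'] Cn => [/(_ C)|/(_ C (zC _))]; last by rewrite ltxx.
by move: C0; rewrite mul0r in Cn; rewrite (lt_geF Cn).
Qed.

(** For P vanishing at all the values in w but x, the combination
    of consecutive power sums with the coefficients of P is a nonzero constant
    times x^m. So x^m is bounded by a constant times B^m, and no cancellation
    between several values of maximal modulus can spoil the estimate. *)
Lemma psum_bound (w : seq algC) (B C : algC) : 0 < B ->
  (forall m, `|psum w m.+1| <= C * B ^+ m.+1) ->
  forall x, x \in w -> `|x| <= B.
Proof.
move=> B0 H x xw.
pose P : {poly algC} := \prod_(y <- rem x (undup w)) ('X - y%:P).
have Px : P.[x] != 0.
  have -> : (P.[x] == 0) = root P x by [].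
  by rewrite root_prod_XsubC mem_rem_uniq ?undup_uniq // !inE eqxx.
have key m : \sum_(j < size P) P`_j * psum w (m + j) =
             (count_mem x w)%:R * P.[x] * x ^+ m.
  transitivity (\sum_(y <- w) P.[y] * y ^+ m).
    rewrite /psum; under eq_bigr do rewrite mulr_sumr.
    rewrite exchange_big; apply: eq_bigr => y _ /=.
    rewrite horner_coef mulr_suml; apply: eq_bigr => j _.
    by rewrite exprD; ring.
  rewrite (bigID (pred1 x)) /= [X in _ + X]big1_seq ?addr0 => [|y /andP[yx yw]].
    rewrite (eq_bigr (fun=> P.[x] * x ^+ m)) => [|y /eqP-> //].
    by rewrite big_const_seq iter_addr_0 -mulrA mulr_natl.
  have /eqP -> : root P y by rewrite root_prod_XsubC mem_rem_uniq ?undup_uniq // !inE yx mem_undup.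
  by rewrite mul0r.
pose C' := \sum_(j < size P) `|P`_j| * (C * B ^+ j).
have cx0 : 0 < `|(count_mem x w)%:R * P.[x]|.
  by rewrite normr_gt0 mulf_neq0 // pnatr_eq0 -lt0n -has_count has_pred1.
have main m : `|x| ^+ m.+1 * `|(count_mem x w)%:R * P.[x]| <= C' * B ^+ m.+1.
  rewrite -normrX -normrM mulrC -key (le_trans (ler_norm_sum _ _ _)) //.
  rewrite /C' mulr_suml; apply: ler_sum => j _.
  rewrite normrM -mulrA ler_wpM2l // addSn (le_trans (H _)) //.
  by rewrite -addSn exprD mulrA mulrAC.
have : `|x| / B <= 1.
  apply: (@expr_bound_le1 _ (C' / `|(count_mem x w)%:R * P.[x]|)).
    by rewrite divr_ge0 // ltW.
  move=> m; rewrite ler_pdivlMr // expr_div_n mulrAC ler_pdivrMr ?exprn_gt0 //.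
by rewrite ler_pdivrMr // mul1r.
Qed.

(** * Products of linear factors *)

Lemma prod_XsubC_perm (F : fieldType) (s1 s2 : seq F) :
  \prod_(x <- s1) ('X - x%:P) = \prod_(x <- s2) ('X - x%:P) -> perm_eq s1 s2.
Proof.
move=> E; apply/allP => x _ /=; apply/eqP.
by rewrite -!mu_prod_XsubC E.
Qed.

Lemma dvdp_prod_XsubC_count (F : fieldType) (s1 s2 : seq F) :
  reflect (forall x, count_mem x s1 <= count_mem x s2)%N
    (\prod_(x <- s1) ('X - x%:P) %| \prod_(x <- s2) ('X - x%:P)).
Proof.
have nz s : \prod_(x <- s) ('X - x%:P) != 0 :> {poly F}.
  by rewrite monic_neq0 // monic_prod_XsubC.
apply: (iffP idP) => [/dvdpP[g E] x|].
  rewrite -!mu_prod_XsubC E mupM ?leq_addl //.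
  by apply: contraTneq (nz s2) => g0; rewrite E g0 mul0r eqxx.
elim: s1 s2 => [|x s IH] s2 le12; first by rewrite big_nil dvd1p.
have xs2 : x \in s2.
  by rewrite -has_pred1 has_count (leq_trans _ (le12 x)) //= eqxx.
rewrite (perm_big _ (perm_to_rem xs2)) !big_cons dvdp_mul2l ?polyXsubC_eq0 //.
apply: IH => y; have := le12 y.
by rewrite (permP (perm_to_rem xs2)) /= leq_add2l.
Qed.

Lemma sum_count_undup (T : eqType) (s : seq T) :
  (\sum_(x <- undup s) count_mem x s = size s)%N.
Proof.
rewrite -[RHS]sum1_size -(big_undup_iterop_count addn s predT (fun=> 1%N)).
by apply: eq_bigr => x _; rewrite Monoid.iteropE iter_addn_0 mul1n.
Qed.

(** * Linear relations between polynomials *)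

Lemma poly_lin_dep (K : fieldType) (T : finType) (P : T -> {poly K}) M :
  (forall t, (size (P t) <= M)%N) -> (M < #|T|)%N ->
  exists2 g : T -> K, exists t, g t != 0 & \sum_t g t *: P t = 0.
Proof.
move=> sP MT.
pose A : 'M[K]_(#|T|, M) := \matrix_(i < #|T|) poly_rV (P (enum_val i)).
have : kermx A != 0.
  by rewrite kermx_eq0 -row_leq_rank -ltnNge (leq_ltn_trans (rank_leq_col A)).
case/rowV0Pn => v /sub_kermxP vA v0.
exists (fun t => v 0 (enum_rank t)).
  case/rV0Pn: v0 => i vi; exists (enum_val i); by rewrite enum_valK.
apply/polyP => j; rewrite coef0 coef_sum.
have [jM|Mj] := ltnP j M; last first.
  by apply: big1 => t _; rewrite coefZ nth_default ?mulr0 // (leq_trans (sP t)).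
have := congr1 (fun B : 'rV_M => B 0 (Ordinal jM)) vA; rewrite !mxE.
apply: etrans.
rewrite (reindex _ (onW_bij _ (@enum_val_bij T))) /=.
by apply: eq_bigr => i _; rewrite enum_valK coefZ !mxE.
Qed.

(** The term of largest size among those with a nonzero coefficient cannot be
    cancelled. *)
Lemma poly_size_indep (K : idomainType) (T : finType) (Q : T -> {poly K})
  (g : T -> K) : (forall t, Q t != 0) -> injective (fun t => size (Q t)) ->
  (exists t, g t != 0) -> \sum_t g t *: Q t != 0.
Proof.
move=> Q0 injQ [t0 gt0].
case: (@arg_maxnP T t0 (fun t => g t != 0) (fun t => size (Q t)) gt0) => t gt max_t.
apply/eqP => /(congr1 (fun R : {poly K} => R`_(size (Q t)).-1)).
rewrite coef0 coef_sum (bigD1 t) //= big1 ?addr0 => [|u ut].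
  rewrite coefZ -lead_coefE => /eqP; rewrite mulf_eq0 lead_coef_eq0.
  by rewrite (negPf gt) (negPf (Q0 t)).
rewrite coefZ; have [->|gu] := eqVneq (g u) 0; first by rewrite mul0r.
rewrite nth_default ?mulr0 // -ltnS prednK ?size_poly_gt0 //.
by rewrite ltn_neqAle [(_ <= _)%N]max_t // andbT (inj_eq injQ).
Qed.

Lemma mul_modn_inj p D i j : coprime p D -> (i < p)%N -> (j < p)%N ->
  (D * i = D * j %[mod p])%N -> i = j.
Proof.
move=> pD; wlog ij : i j / (i <= j)%N => [W|] ip jp E.
  by case: (leqP i j) => [/W|/ltnW/W]; [exact | move/(_ jp ip (esym E))].
move/eqP: E; rewrite eq_sym eqn_mod_dvd ?leq_mul2l ?ij ?orbT // -mulnBr Gauss_dvdr //.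
rewrite /dvdn modn_small ?(leq_ltn_trans (leq_subr _ _)) // subn_eq0 => ji.
by apply/eqP; rewrite eqn_leq ij.
Qed.

(** * Finite fields inside an algebraically closed field *)

Section FixedField.
Variables (K : closedFieldType) (p : nat).
Hypothesis charp : p \in [pchar K].

Let p_pr : prime p := pcharf_prime charp.
Let p_gt0 := prime_gt0 p_pr.
Let p_gt1 := prime_gt1 p_pr.

Lemma frobD i (x y : K) : (x + y) ^+ (p ^ i) = x ^+ (p ^ i) + y ^+ (p ^ i).
Proof.
apply: exprDn_pchar; rewrite pnatX; apply/orP; left.
by rewrite pnatE // charp.
Qed.

Lemma frob_sum i (I : Type) (s : seq I) (F : I -> K) :
  (\sum_(x <- s) F x) ^+ (p ^ i) = \sum_(x <- s) F x ^+ (p ^ i).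
Proof.
elim: s => [|x s IH]; first by rewrite !big_nil expr0n expn_eq0 gtn_eqF.
by rewrite !big_cons frobD IH.
Qed.

Lemma frob_inj i : injective (fun x : K => x ^+ (p ^ i)).
Proof.
move=> x y /= /eqP; rewrite -subr_eq0 => xy.
have : (x - y) ^+ (p ^ i) == 0.
  rewrite frobD; suff -> : (- y) ^+ (p ^ i) = - y ^+ (p ^ i) by [].
  apply/eqP; rewrite -addr_eq0 -frobD addNr expr0n expn_eq0 gtn_eqF //.
by rewrite expf_eq0 subr_eq0 => /andP[_ /eqP].
Qed.

Lemma frob_root i (a : K) : exists x, x ^+ (p ^ i) == a.
Proof.
have q0 : (0 < p ^ i)%N by rewrite expn_gt0 p_gt0.
have [x] := solve_monicpoly (fun j => if j == 0%N then a else 0) q0.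
move=> xE; exists x; move: xE; rewrite -(prednK q0) big_ord_recl /= mulr1 => ->.
by rewrite big1 ?addr0 // => j _; rewrite mul0r.
Qed.

Definition fix_field (q : nat) : seq K :=
  sval (closed_field_poly_normal ('X^q - 'X : {poly K})).

Lemma fix_fieldE q : (1 < q)%N ->
  'X^q - 'X = \prod_(x <- fix_field q) ('X - x%:P) :> {poly K}.
Proof.
move=> q1; rewrite {1}/fix_field; case: closed_field_poly_normal => r /= {1}->.
suff -> : lead_coef ('X^q - 'X : {poly K}) = 1 by rewrite scale1r.
by rewrite lead_coefDl ?lead_coefXn // size_polyN size_polyX size_polyXn.
Qed.

Lemma mem_fix_field q x : (1 < q)%N -> (x \in fix_field q) = (x ^+ q == x).
Proof.
by move=> q1; rewrite -root_prod_XsubC -fix_fieldE // rootE !hornerE subr_eq0.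
Qed.

Lemma size_fix_field q : (1 < q)%N -> size (fix_field q) = q.
Proof.
move=> q1; apply: succn_inj; rewrite -(size_prod_XsubC _ id) -fix_fieldE //.
by rewrite size_polyDl ?size_polyXn // size_polyN size_polyX.
Qed.

Lemma ltn_expp R : (0 < R)%N -> (1 < p ^ R)%N.
Proof. by move=> R0; rewrite -(expn0 p) ltn_exp2l. Qed.

Lemma uniq_fix_field R : (0 < R)%N -> uniq (fix_field (p ^ R)).
Proof.
move=> R0; rewrite -separable_prod_XsubC -fix_fieldE ?ltn_expp //.
rewrite unlock /separable_poly derivB derivXn derivX.
have -> : 'X^((p ^ R).-1) *+ (p ^ R) = 0 :> {poly K}.
  have p0 : p%:R = 0 :> {poly K} by apply: pcharf0; rewrite pchar_poly.
  by rewrite -(prednK R0) expnS -mulr_natr natrM p0 mul0r mulr0.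
by rewrite sub0r -[X in coprimep _ X]scaleN1r coprimepZr ?oppr_eq0 ?oner_eq0 // coprimep1.
Qed.

Definition abs_trace R (x : K) : K := \sum_(i < R) x ^+ (p ^ i).

Lemma abs_traceD R x y : abs_trace R (x + y) = abs_trace R x + abs_trace R y.
Proof. by rewrite /abs_trace -big_split; apply: eq_bigr => i _; rewrite frobD. Qed.

Lemma abs_trace0 R : abs_trace R 0 = 0.
Proof. by apply: big1 => i _; rewrite expr0n expn_eq0 gtn_eqF. Qed.

(** With s = p^m, the trace from the field with s^2 elements is A + A^s where A
    has only half of the terms. *)
Lemma abs_trace_dbl m x :
  abs_trace (m + m) x = abs_trace m x + abs_trace m x ^+ (p ^ m).
Proof.
rewrite /abs_trace big_split_ord /= frob_sum; congr (_ + _).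
by apply: eq_bigr => i _; rewrite -exprM -expnD addnC.
Qed.

Lemma abs_trace_fix R x : x \in fix_field (p ^ R) -> (0 < R)%N ->
  abs_trace R x \in fix_field p.
Proof.
move=> xE R0; move: xE; rewrite !mem_fix_field ?ltn_expp // => /eqP xE.
have := frob_sum 1 (index_enum 'I_R) (fun i => x ^+ (p ^ i)).
rewrite expn1 -/(abs_trace R x) => ->; rewrite /abs_trace.
case: R R0 xE => // R _ xE; rewrite big_ord_recr big_ord_recl /= addrC.
rewrite -exprM -expnSr xE expn0 expr1; apply/eqP; congr (_ + _).
by apply: eq_bigr => i _; rewrite -exprM -expnSr.
Qed.

Lemma size_abs_trace_poly (h : {poly K}) D m : size h = D.+1 -> (0 < D)%N ->
  size (\sum_(i < m.+1) h ^+ (p ^ i)) = (D * p ^ m).+1.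
Proof.
move=> sh D0; have h0 : h != 0 by rewrite -size_poly_eq0 sh.
have szX i : size (h ^+ (p ^ i)) = (D * p ^ i).+1.
  have := size_exp h (p ^ i); rewrite sh /= => <-.
  by rewrite prednK // size_poly_gt0 expf_neq0.
elim: m => [|m IH]; first by rewrite big_ord1 szX.
have lt : (D * p ^ m < D * p ^ m.+1)%N by rewrite ltn_pmul2l ?ltn_exp2l ?p_gt1.
by rewrite big_ord_recr /= addrC size_polyDl szX // IH ltnS.
Qed.

(** * Stepanov's bound *)

(** Write s = p^(m+1), b = s/p and let A be the sum of the h^(p^i), i <= m, of
    degree D b, so that the trace of h(y) is A(y) + A(y)^s.  Consider
      G = sum of g^(1/s) X^(l + s i) A^j   over i < I, j < p, l < b.
    Its terms have distinct degrees l + b (p i + D j), because p does not divide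
    D; so G is nonzero as soon as some g is.  At a point y of trace c,
      G(y)^s = sum of g y^(s l + i) (c - A(y))^j,
    a polynomial in y of degree about s b + s D, while there are s I unknowns g:
    for I = b + D + 2 they can be chosen so that it is identically zero.  Then
    all the points are roots of G, of degree about s I.  The case D > s
    follows from the trivial bound s^2. *)
Lemma stepanov_bound (h : {poly K}) D m c : size h = D.+1 -> (0 < D)%N ->
  ~~ (p %| D)%N ->
  (count (fun y => abs_trace (m.+1 + m.+1) h.[y] == c)
     (fix_field (p ^ (m.+1 + m.+1)))
    <= p ^ m.+1 * (p ^ m + 2 * D + 2))%N.
Proof.
move=> sh D0 pD.
set b := (p ^ m)%N; set s := (p ^ m.+1)%N.
have sb : s = (p * b)%N by rewrite /s expnS.
have b0 : (0 < b)%N by rewrite expn_gt0 p_gt0.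
have qs : (p ^ (m.+1 + m.+1) = s * s)%N by rewrite expnD.
rewrite qs.
have s1 : (1 < s)%N by apply: ltn_expp.
have ss1 : (1 < s * s)%N by rewrite -qs ltn_expp.
have [Ds|sD] := leqP D s; last first.
  rewrite (leq_trans (count_size _ _)) // size_fix_field // leq_mul2l; lia.
pose I := (b + D + 2)%N.
pose A : {poly K} := \sum_(i < m.+1) h ^+ (p ^ i).
have sA : size A = (D * b).+1 by apply: size_abs_trace_poly.
have Ay y : A.[y] = abs_trace m.+1 h.[y].
  by rewrite /A horner_sum; apply: eq_bigr => i _; rewrite horner_exp.
have A0 : A != 0 by rewrite -size_poly_eq0 sA.
pose T : finType := ('I_I * 'I_p * 'I_b)%type.
(* The s-th powers of the terms of G, once reduced by the two relations. *)
pose P (t : T) : {poly K} := 'X^(s * t.2 + t.1.1) * (c%:P - A) ^+ t.1.2.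
have szcA : (size (c%:P - A)%R <= (D * b).+1)%N.
  rewrite (leq_trans (size_polyD _ _)) // geq_max size_polyN sA leqnn andbT.
  by rewrite (leq_trans (size_polyC_leq1 _)).
have sP t : (size (P t) <= s * (b - 1) + I + p * D * b)%N.
  case: t => [[i j] l]; rewrite /P /= (leq_trans (size_polyMleq _ _)) //.
  rewrite size_polyXn addSn /=.
  have := size_poly_exp_leq (c%:P - A) j.
  move: (size (polyseq (_ ^+ j))) => u.
  move: (size (polyseq _)) szcA => w szcA uw.
  have jp := ltn_ord j; have li := ltn_ord l; have ii := ltn_ord i.
  have : (w.-1 * j <= D * b * (p - 1))%N by apply: leq_mul; lia.
  have : (s * l <= s * (b - 1))%N by rewrite leq_mul2l; lia.
  have : (D * b * (p - 1) <= p * D * b)%N.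
    by rewrite mulnC mulnA leq_mul // leq_mul // leq_subr.
  lia.
have cT : (s * (b - 1) + I + p * D * b < #|T|)%N.
  rewrite !card_prod !card_ord /I.
  have : (b + b <= s)%N by rewrite sb addnn -mul2n leq_mul2r p_gt1 orbT.
  have e1 : (p * D * b = s * D)%N by rewrite sb mulnAC.
  have e2 : ((b + D + 2) * p * b = s * b + s * D + s + s)%N.
    by rewrite sb; lia.
  have e3 : (s * (b - 1) + s = s * b)%N by rewrite -mulnSr; congr (_ * _)%N; lia.
  rewrite e1 e2; lia.
have [g gn0 gP] := poly_lin_dep sP cT.
(* The unknowns are the coefficients of G^s, in which the system is linear;
   those of G are their s-th roots. *)
pose r a := xchoose (frob_root m.+1 a).
have rE a : r a ^+ s = a by apply/eqP/(xchooseP (frob_root m.+1 a)).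
pose Q (t : T) : {poly K} := 'X^(t.2 + s * t.1.1) * A ^+ t.1.2.
have sQ t : size (Q t) = (t.2 + b * (p * t.1.1 + D * t.1.2)).+1.
  have As : A ^+ t.1.2 != 0 by rewrite expf_neq0.
  rewrite /Q size_monicM ?monicXn // size_polyXn addSn /=.
  have := size_exp A t.1.2; rewrite sA /=.
  have : (0 < size (A ^+ t.1.2))%N by rewrite size_poly_gt0.
  move: (size (polyseq _)) => u; rewrite sb; lia.
pose G := \sum_t r (g t) *: Q t.
have G0 : G != 0.
  apply: poly_size_indep.
  - by move=> t; rewrite -size_poly_eq0 sQ.
  - move=> [[i j] l] [[i' j'] l'] /=; rewrite !sQ /= => -[E].
    have li := ltn_ord l; have li' := ltn_ord l'.
    (* l is read modulo b, then j modulo p. *)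
    have El : l = l' :> nat.
      have := congr1 (modn^~ b) E.
      by rewrite /= !(addnC (nat_of_ord _)) ![(b * _)%N]mulnC !modnMDl !modn_small.
    move: E; rewrite El => /addnI/eqP; rewrite eqn_pmul2l // => /eqP E.
    have Ej : j = j' :> nat.
      apply: (@mul_modn_inj p D); rewrite ?prime_coprime //.
      have := congr1 (modn^~ p) E.
      by rewrite /= ![(p * _)%N]mulnC !modnMDl.
    move: E; rewrite Ej => /addIn/eqP; rewrite eqn_pmul2l // => /eqP Ei.
    by congr (_, _, _); apply: val_inj.
  - case: gn0 => t gt; exists t; apply: contraNneq gt => rg.
    by rewrite -(rE (g t)) rg expr0n; case: (s) s1.
have sG : (size G <= s * (b + 2 * D + 2))%N.
  rewrite (leq_trans (size_sum _ _ _)) //; apply/bigmax_leqP => -[[i j] l] _.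
  rewrite (leq_trans (size_scale_leq _ _)) // sQ /=.
  have li := ltn_ord l; have ii := ltn_ord i; have jp := ltn_ord j.
  have : (s * i <= s * (b + D + 1))%N by rewrite leq_mul2l; lia.
  have : (b * D * j <= s * D)%N by rewrite sb mulnC mulnA leq_mul // leq_mul // ltnW.
  have : (b <= s)%N by rewrite sb leq_pmull.
  rewrite sb; lia.
rewrite -size_filter; set ys := filter _ _.
have uys : uniq ys by rewrite filter_uniq // -qs uniq_fix_field.
rewrite (leq_trans _ sG) // ltnW // max_poly_roots //.
apply/allP => y; rewrite mem_filter mem_fix_field // => /andP[/eqP Ty /eqP yq].
have As : A.[y] ^+ s = c - A.[y].
  by rewrite -Ty abs_trace_dbl -Ay addrC addKr.
suff : G.[y] ^+ s == 0 by rewrite expf_eq0 rootE => /andP[].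
apply/eqP; transitivity (\sum_t g t *: P t).[y]; last by rewrite gP horner0.
rewrite /G !horner_sum frob_sum; apply: eq_bigr => -[[i j] l] _.
rewrite !hornerZ !hornerM !exprMn rE !horner_exp !hornerX hornerD hornerN hornerC -As.
congr (_ * (_ * _)); last by rewrite -!exprM mulnC.
have -> : y ^+ (l + s * i) ^+ s = y ^+ (s * l) * (y ^+ (s * s)) ^+ i.
  by rewrite -!exprM -exprD; congr (_ ^+ _); lia.
by rewrite yq exprD.
Qed.

End FixedField.

(** * Additive characters *)

Section AddChar.
Variables (K : closedFieldType) (p : nat).
Hypothesis charp : p \in [pchar K].
Variable z : algC.
Hypothesis prim_z : p.-primitive_root z.

Let p_pr : prime p := pcharf_prime charp.
Let p_gt0 := prime_gt0 p_pr.
Let p_gt1 := prime_gt1 p_pr.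

Definition prime_subfield : seq K := mkseq (fun c => c%:R) p.

Lemma uniq_prime_subfield : uniq prime_subfield.
Proof.
rewrite map_inj_in_uniq ?iota_uniq // => i j; rewrite !mem_iota !add0n /= => ip jp.
wlog ij : i j ip jp / (i <= j)%N => [W|] E.
  by case: (leqP i j) => [/W|/ltnW/W]; [exact | move/(_ jp ip (esym E))].
have : (j - i)%:R == 0 :> K by rewrite natrB // E subrr.
rewrite -(dvdn_pcharf charp) /dvdn modn_small; last exact: leq_ltn_trans (leq_subr _ _) jp.
by rewrite subn_eq0 => ji; apply/eqP; rewrite eqn_leq ij.
Qed.

Lemma fix_field_prime : fix_field K p =i prime_subfield.
Proof.
have up : uniq (fix_field K p) by rewrite -[p]expn1; apply: uniq_fix_field.
apply/fsym/(uniq_min_size uniq_prime_subfield _ _).2; last first.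
  by rewrite size_fix_field // size_mkseq.
move=> x /mapP[c _ ->]; rewrite mem_fix_field //.
by rewrite -[_ ^+ p](pFrobenius_autE charp) pFrobenius_aut_nat.
Qed.

Lemma prime_subfield_ord x : x \in fix_field K p ->
  exists2 c : 'I_p, x = c%:R & forall d : 'I_p, (x == d%:R) = (d == c).
Proof.
rewrite fix_field_prime => /mapP[c]; rewrite mem_iota add0n => /andP[_ cp] xc.
exists (Ordinal cp) => // d; rewrite xc -val_eqE /= eq_sym.
have := nth_uniq 0 _ _ uniq_prime_subfield => /(_ d c).
by rewrite !size_mkseq !nth_mkseq //; exact.
Qed.

(** An element of the prime field has the same index as the integer below p
    that it represents; [add_char] is a character there only. *)
Definition add_char (x : K) : algC := z ^+ index x prime_subfield.

Lemma add_char_nat c : add_char c%:R = z ^+ c.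
Proof.
rewrite -(GRing.natr_mod_pchar charp) -(prim_expr_mod prim_z) /add_char.
have cp : (c %% p < p)%N by rewrite ltn_pmod.
rewrite -[in LHS](nth_mkseq 0 (fun c => c%:R : K) cp).
by rewrite index_uniq ?uniq_prime_subfield // size_mkseq.
Qed.

Lemma add_charD x y : x \in fix_field K p -> y \in fix_field K p ->
  add_char (x + y) = add_char x * add_char y.
Proof.
rewrite !fix_field_prime => /mapP[c _ ->] /mapP[d _ ->].
by rewrite -natrD !add_char_nat exprD.
Qed.

Lemma add_char0 : add_char 0 = 1.
Proof. by rewrite (add_char_nat 0). Qed.

Lemma norm_add_char x : `|add_char x| = 1.
Proof.
have /eqP zp : `|z| ^+ p == 1 by rewrite -normrX (prim_expr_order prim_z) normr1.
have /eqP zn : `|z| == 1 by rewrite -(pexpr_eq1 p_gt0 (normr_ge0 _)) zp.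
by rewrite /add_char normrX zn expr1n.
Qed.

Lemma add_char_neq1 x : x \in fix_field K p -> x != 0 -> add_char x != 1.
Proof.
rewrite fix_field_prime => /mapP[c _ ->]; rewrite -(dvdn_pcharf charp) add_char_nat.
by rewrite -(prim_order_dvd prim_z).
Qed.

Lemma sum_prim_root : \sum_(c < p) z ^+ c = 0.
Proof.
have z1 : z - 1 != 0.
  by rewrite subr_eq0 -[z]expr1 -(prim_order_dvd prim_z) dvdn1 gtn_eqF.
by apply: (mulfI z1); rewrite -subrX1 (prim_expr_order prim_z) subrr mulr0.
Qed.

(** The character of the field with p^R elements is the one of the prime field
    composed with the absolute trace. *)
Definition char_sum R (h : {poly K}) : algC :=
  \sum_(y <- fix_field K (p ^ R)) add_char (abs_trace p R h.[y]).

Lemma horner_frob R (h : {poly K}) x :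
  (forall i, h`_i ^+ (p ^ R) = h`_i) -> h.[x] ^+ (p ^ R) = h.[x ^+ (p ^ R)].
Proof.
move=> hq; rewrite !horner_coef (frob_sum charp); apply: eq_bigr => i _.
by rewrite exprMn hq -!exprM mulnC.
Qed.

(** Stepanov's upper bound for each of the p fibres of the trace is also a lower
    bound, since the fibres add up to the whole field; so each of them has
    p^(R-1) elements up to O(p^(R/2)), and the main terms cancel in the sum. *)
Lemma char_sum_even (h : {poly K}) D m : size h = D.+1 -> (0 < D)%N ->
  ~~ (p %| D)%N -> (forall i, h`_i ^+ (p ^ (m.+1 + m.+1)) = h`_i) ->
  `|char_sum (m.+1 + m.+1) h| <= (2 * p * (2 * D + 2))%:R * (p ^ m.+1)%:R.
Proof.
move=> sh D0 pD hq; set R := (m.+1 + m.+1)%N in hq *.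
have q1 : (1 < p ^ R)%N by apply: (ltn_expp charp).
pose t y := abs_trace p R h.[y].
have tE y : y \in fix_field K (p ^ R) -> t y \in fix_field K p.
  move=> yE; apply: (abs_trace_fix charp); rewrite // mem_fix_field //.
  by rewrite horner_frob //; move: yE; rewrite mem_fix_field // => /eqP->.
pose N c := count (fun y => t y == c%:R) (fix_field K (p ^ R)).
have SE : char_sum R h = \sum_(c < p) z ^+ c * (N c)%:R.
  transitivity (\sum_(y <- fix_field K (p ^ R)) \sum_(c < p | t y == c%:R) z ^+ c).
    apply: eq_big_seq => y /tE/prime_subfield_ord[c tc tcE].
    by rewrite (big_pred1 c) // -/(t y) tc add_char_nat.
  rewrite (exchange_big_dep predT) //=; apply: eq_bigr => c _.
  by rewrite big_const_seq iter_addr_0 mulr_natr.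
have NT : (\sum_(c < p) N c = p ^ R)%N.
  rewrite -[RHS](size_fix_field K q1) -sum1_size.
  transitivity (\sum_(y <- fix_field K (p ^ R)) \sum_(c < p | t y == c%:R) 1)%N.
    by rewrite (exchange_big_dep predT) //=; apply: eq_bigr => c _; rewrite sum1_count.
  apply: eq_big_seq => y /tE/prime_subfield_ord[c tc tcE].
  by rewrite (big_pred1 c).
pose X : algC := (p ^ (m + m.+1))%:R.
pose d : algC := (p ^ m.+1 * (2 * D + 2))%:R.
have NX c : (N c)%:R <= X + d.
  rewrite -natrD ler_nat; have := stepanov_bound charp m c%:R sh D0 pD.
  by rewrite -/R -/(N c) -addnA mulnDr expnD [(p ^ m * _)%N]mulnC.
have d0 : 0 <= d by rewrite ler0n.
have -> : char_sum R h = \sum_(c < p) z ^+ c * ((N c)%:R - X).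
  under [RHS]eq_bigr do rewrite mulrBr.
  by rewrite sumrB -mulr_suml sum_prim_root mul0r subr0.
rewrite (le_trans (ler_norm_sum _ _ _)) //.
(* An upper bound x <= d gives |x| <= 2 d - x, which can be summed. *)
have le1 c : `|z ^+ c * ((N c)%:R - X)| <= d + (d - ((N c)%:R - X)).
  have -> : z ^+ c = add_char c%:R by rewrite add_char_nat.
  rewrite normrM norm_add_char mul1r.
  have {1}-> : (N c)%:R - X = d - (d - ((N c)%:R - X)) by ring.
  rewrite (le_trans (ler_normB _ _)) // ger0_norm // lerD2l ger0_norm //.
  by rewrite subr_ge0 lerBlDl.
rewrite (le_trans (ler_sum _ (fun (c : 'I_p) _ => le1 c))) //.
have NT' : \sum_(c < p) (N c)%:R = (p ^ R)%:R :> algC by rewrite -natr_sum NT.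
rewrite big_split /= sumrB sumrB NT' !sumr_const card_ord.
have -> : (p ^ R)%:R = X *+ p by rewrite /X -mulrnA -expnSr.
rewrite subrr subr0 -mulrnDr /d -mulrnA -natrM ler_nat.
lia.
Qed.
End AddChar.

(** * Frobenius orbits and polynomials over a finite subfield *)

Section Lfunction.
Variables (K : closedFieldType) (p : nat).
Hypothesis charp : p \in [pchar K].
Variable R : nat.
Hypothesis R_gt0 : (0 < R)%N.

Let p_pr : prime p := pcharf_prime charp.
Let p_gt0 := prime_gt0 p_pr.
Let p_gt1 := prime_gt1 p_pr.
Let q := (p ^ R)%N.
Let q_gt1 : (1 < q)%N. Proof. exact: (ltn_expp charp). Qed.

Definition frob (x : K) : K := x ^+ (p ^ R).

Fact frob_is_zmod_morphism : zmod_morphism frob.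
Proof.
move=> x y; rewrite /frob (frobD charp); congr (_ + _).
apply/eqP; rewrite -addr_eq0 -(frobD charp) addNr expr0n expn_eq0.
by rewrite gtn_eqF.
Qed.
Fact frob_is_monoid_morphism : monoid_morphism frob.
Proof. by split=> [|x y]; rewrite /frob ?expr1n ?exprMn. Qed.
HB.instance Definition _ := GRing.isZmodMorphism.Build K K frob frob_is_zmod_morphism.
HB.instance Definition _ := GRing.isMonoidMorphism.Build K K frob frob_is_monoid_morphism.

Lemma iter_frob l x : iter l frob x = x ^+ (q ^ l).
Proof.
by elim: l => [|l IH]; rewrite ?expr1 // iterS IH /frob -exprM -expnSr.
Qed.

Lemma frobI : injective frob. Proof. exact: (@frob_inj _ _ charp R). Qed.

(** Invariance under Frobenius puts the coefficients in the field with q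
    elements. *)
Definition rational (g : {poly K}) := map_poly frob g == g.

Lemma rationalP (g : {poly K}) : reflect (forall i, g`_i ^+ q = g`_i) (rational g).
Proof.
apply: (iffP eqP) => [E i|E]; last by apply/polyP => i; rewrite coef_map; apply: E.
by rewrite -{2}E coef_map.
Qed.

Lemma rationalD (g g' : {poly K}) : rational g -> rational g' -> rational (g + g').
Proof. by rewrite /rational rmorphD /= => /eqP-> /eqP->. Qed.

Lemma rationalM (g g' : {poly K}) : rational g -> rational g' -> rational (g * g').
Proof. by rewrite /rational rmorphM /= => /eqP-> /eqP->. Qed.

Lemma rational_divl (g g' : {poly K}) : g \is monic -> rational g -> rational (g * g') -> rational g'.
Proof.
rewrite /rational rmorphM /= => g1 /eqP-> /eqP /(mulfI (monic_neq0 g1)) ->.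
exact: eqxx.
Qed.

Lemma mem_fixq x : (x \in fix_field K q) = (frob x == x).
Proof. by rewrite mem_fix_field. Qed.

Fixpoint monics m : seq {poly K} :=
  if m is m'.+1 then
    [seq g * 'X + c%:P | g <- monics m', c <- fix_field K q] else [:: 1].

Lemma mem_monics m (g : {poly K}) :
  (g \in monics m) = [&& g \is monic, size g == m.+1 & rational g].
Proof.
elim: m g => [|m IH] g /=.
  rewrite inE; apply/eqP/and3P => [->|[g1 /size_poly1P[c _ gc] _]].
    by rewrite monic1 size_poly1 /rational rmorph1 eqxx.
  by move: g1; rewrite gc qualifE /= lead_coefC => /eqP->.
apply/allpairsP/and3P => [[[f c] /= [+ cE ->]]|[g1 /eqP sg rg]].
  rewrite IH => /and3P[f1 /eqP sf rf]; split.
  - rewrite qualifE /= lead_coefDl ?lead_coefMX // size_polyC.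
    by rewrite size_mulX ?monic_neq0 // sf; case: eqP.
  - by rewrite size_MXaddC (negPf (monic_neq0 f1)) sf.
  - rewrite /rational rmorphD rmorphM /= map_polyX map_polyC /= (eqP rf).
    by move: cE; rewrite mem_fixq => /eqP->.
have [f [c gE]] : exists f c, g = f * 'X + c%:P.
  exists (\poly_(i < m.+1) g`_i.+1), g`_0; apply/polyP => i.
  rewrite coefD coefMX coefC coef_poly; case: i => [|i] /=; rewrite ?add0r ?addr0 //.
  by case: ltnP => // ?; rewrite nth_default // sg.
have f0 : f != 0.
  by apply: contra_eq_neq sg => f0; rewrite gE f0 mul0r add0r size_polyC; case: (c != 0).
exists (f, c); split=> //=.
  rewrite IH; apply/and3P; split.
  - move: g1; rewrite gE !qualifE /= lead_coefDl ?lead_coefMX // size_polyC.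
    by rewrite size_mulX // ltnS; case: (c != 0); rewrite ?size_poly_gt0.
  - by move: sg; rewrite gE size_MXaddC (negPf f0) /= => -[->].
  - apply/rationalP => i; move/rationalP: rg => /(_ i.+1).
    by rewrite gE coefD coefMX coefC /= addr0.
rewrite mem_fixq; move/rationalP: rg => /(_ 0%N).
by rewrite gE coefD coefMX coefC /= add0r /frob => ->.
Qed.

Lemma uniq_monics m : uniq (monics m).
Proof.
elim: m => //= m IH; apply: allpairs_uniq => //.
  exact: (uniq_fix_field charp R_gt0).
move=> [f c] [f' c'] _ _ /= E.
have Ec : c = c'.
  by move: (congr1 (fun g : {poly K} => g`_0) E); rewrite !coefD !coefMX !coefC /= !add0r.
by move: E; rewrite Ec => /addIr /(mulIf (negbT (polyX_eq0 K))) ->.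
Qed.

Definition rts (g : {poly K}) : seq K := sval (closed_field_poly_normal g).

Lemma rtsE g : g \is monic -> g = \prod_(x <- rts g) ('X - x%:P).
Proof.
move=> /monicP g1; rewrite /rts; case: closed_field_poly_normal => s /=.
by rewrite g1 scale1r.
Qed.

Lemma size_rts g : g \is monic -> size g = (size (rts g)).+1.
Proof. by move=> g1; rewrite {1}(rtsE g1) size_prod_XsubC. Qed.

Lemma perm_rts s : perm_eq (rts (\prod_(x <- s) ('X - x%:P))) s.
Proof. by apply: prod_XsubC_perm; rewrite -rtsE // monic_prod_XsubC. Qed.

Lemma perm_rtsM g g' : g \is monic -> g' \is monic ->
  perm_eq (rts (g * g')) (rts g ++ rts g').
Proof.
move=> g1 g'1; apply: prod_XsubC_perm; rewrite big_cat /=.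
by rewrite -!rtsE // monicMl.
Qed.

Lemma perm_frob_rts g : g \is monic -> rational g ->
  perm_eq (map frob (rts g)) (rts g).
Proof.
move=> g1 /eqP rg; apply: prod_XsubC_perm; rewrite big_map.
by rewrite -map_prod_XsubC -rtsE.
Qed.

Definition orb r (x : K) : seq K := traject frob x r.
(** For x in the extension of degree r, this is the characteristic polynomial of
    x, that is, a power of its minimal polynomial. *)
Definition orb_poly r x : {poly K} := \prod_(y <- orb r x) ('X - y%:P).

Lemma map_frob_orb r x : map frob (orb r x) = orb r (frob x).
Proof. by rewrite /orb; elim: r x => //= r IH x; rewrite IH. Qed.

Lemma perm_frob_orb r x : (0 < r)%N -> x ^+ (q ^ r) = x ->
  perm_eq (map frob (orb r x)) (orb r x).
Proof.
case: r => // r _; rewrite -iter_frob map_frob_orb /orb iterSr trajectSr => ->.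
by rewrite perm_rcons.
Qed.

Lemma iter_frob_cancel i j x : (i <= j)%N -> iter j frob x = iter i frob x ->
  iter (j - i) frob x = x.
Proof.
move=> ij; rewrite -{1}(subnKC ij) iterD; move: (j - i)%N => e.
elim: i {ij} => //= i IH.
by move/frobI.
Qed.

Lemma orb_poly_monics r x : (0 < r)%N -> x ^+ (q ^ r) = x ->
  orb_poly r x \in monics r.
Proof.
move=> r0 xr; rewrite mem_monics monic_prod_XsubC size_prod_XsubC size_traject eqxx.
rewrite /rational /orb_poly map_prod_XsubC /= -(big_map frob predT (fun y => 'X - y%:P)).
by rewrite (perm_big _ (perm_frob_orb r0 xr)).
Qed.

Lemma orbD a b x : orb (a + b) x = orb a x ++ orb b (iter a frob x).
Proof. by rewrite /orb trajectD. Qed.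

(** The roots of g are permuted by Frobenius, so the orbit of x among them is
    periodic; its least period is the degree of x. *)
Lemma frob_order g x : g \is monic -> rational g -> x \in rts g ->
  exists2 d, (0 < d)%N & iter d frob x = x /\ uniq (orb d x).
Proof.
move=> g1 rg xg.
have ig i : iter i frob x \in rts g.
  elim: i => //= i IH; by rewrite -(perm_mem (perm_frob_rts g1 rg)) map_f.
have exd : exists d, (0 < d)%N && (iter d frob x == x).
  have : ~~ uniq (traject frob x (size (rts g)).+1).
    apply/negP => u.
    have /(uniq_leq_size u) : {subset traject frob x (size (rts g)).+1 <= rts g}.
      by move=> y /trajectP[i _ ->].
    by rewrite size_traject ltnn.
  rewrite looping_uniq negbK => /trajectP[i ilt E].
  exists (size (rts g) - i)%N; rewrite subn_gt0 ilt /=; apply/eqP.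
  by apply: iter_frob_cancel; rewrite // ltnW.
case: (ex_minnP exd) => d /andP[d0 /eqP xd] dmin; exists d => //; split=> //.
case: d d0 xd dmin => // d _ xd dmin.
rewrite /orb looping_uniq; apply/negP => /trajectP[i id E].
have := dmin (d - i)%N; rewrite subn_gt0 id /= iter_frob_cancel ?eqxx ?(ltnW id) //.
by move/(_ isT); rewrite ltnNge leq_subr.
Qed.

Lemma orb_multiple d j x : iter d frob x = x ->
  forall y, count_mem y (orb (d * j) x) = (j * count_mem y (orb d x))%N.
Proof.
move=> xd y; elim: j => [|j IH]; first by rewrite muln0.
by rewrite mulnS orbD xd count_cat IH mulSn.
Qed.

Lemma iter_frob_dvd d x : (0 < d)%N -> iter d frob x = x -> uniq (orb d x) ->
  forall r, (iter r frob x == x) = (d %| r)%N.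
Proof.
move=> d0 xd ux r; rewrite {1}(divn_eq r d) addnC iterD.
have -> : iter (r %/ d * d) frob x = x.
  by rewrite mulnC; elim: (r %/ d)%N => [|j IH]; rewrite ?muln0 // mulnS iterD IH.
rewrite /dvdn; have rd : (r %% d < d)%N by rewrite ltn_pmod.
have := nth_uniq x _ _ ux => /(_ (r %% d)%N 0%N).
by rewrite size_traject !nth_traject //; apply.
Qed.

Lemma count_frob_rts g y : g \is monic -> rational g ->
  count_mem (frob y) (rts g) = count_mem y (rts g).
Proof.
move=> g1 rg; rewrite -(permP (perm_frob_rts g1 rg)) count_map.
by apply: eq_count => x /=; rewrite (inj_eq frobI).
Qed.

Lemma count_orb_rts d g x : g \is monic -> rational g -> forall y,
  y \in orb d x -> count_mem y (rts g) = count_mem x (rts g).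
Proof.
move=> g1 rg y /trajectP[i _ ->]; elim: i => //= i IH.
by rewrite count_frob_rts.
Qed.

(** The left-hand polynomial is the j-th power of the minimal polynomial of x,
    whose roots are simple and have all the same multiplicity in g. *)
Lemma orb_poly_dvd d j g x : g \is monic -> rational g -> (0 < d)%N ->
  iter d frob x = x -> uniq (orb d x) ->
  (orb_poly (d * j) x %| g) = (j <= count_mem x (rts g))%N.
Proof.
move=> g1 rg d0 xd ux; rewrite {1}(rtsE g1).
apply/dvdp_prod_XsubC_count/idP => [/(_ x)|le y].
  rewrite orb_multiple // count_uniq_mem //.
  by case: (d) d0 => // d' _; rewrite inE eqxx muln1.
rewrite orb_multiple // count_uniq_mem //; case: (boolP (y \in _)) => [yo|_].
  by rewrite muln1 (count_orb_rts g1 rg yo).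
by rewrite muln0.
Qed.

(** If x has degree d and multiplicity e in g, the r that contribute are the
    multiples d, 2d, ..., e d; all are at most m, since the e-th power of the
    minimal polynomial divides g. *)
Lemma count_orb_poly_dvd m g x : g \in monics m ->
  (\sum_(1 <= r < m.+1) ((x \in fix_field K (q ^ r)) && (orb_poly r x %| g)%R)
    = count_mem x (rts g))%N.
Proof.
rewrite mem_monics => /and3P[g1 /eqP sg rg].
have sz : size (rts g) = m by apply: succn_inj; rewrite -size_rts.
have [xg|xg] := boolP (x \in rts g); last first.
  rewrite (count_memPn xg) big_nat big1 // => r /andP[r0 _].
  apply/eqP; rewrite eqb0 negb_and orbC; apply/orP; left.
  apply: contraNN xg; rewrite {1}(rtsE g1) => /dvdp_prod_XsubC_count/(_ x).
  case: r r0 => // r _; rewrite /orb /= eqxx => cx.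
  by rewrite -has_pred1 has_count (leq_trans _ cx).
have [d d0 [xd ux]] := frob_order g1 rg xg.
set e := count_mem x (rts g).
have de : (d * e <= m)%N.
  have := leqnn e; rewrite -(orb_poly_dvd e g1 rg d0 xd ux) => /dvdp_leq.
  rewrite monic_neq0 // size_prod_XsubC size_traject sg ltnS; exact.
have cond r : (1 <= r < m.+1)%N ->
  (x \in fix_field K (q ^ r)) && (orb_poly r x %| g)%R = (d %| r)%N && (r %/ d <= e)%N.
  case/andP=> r0 _; have qr : (1 < q ^ r)%N by rewrite /q -expnM (ltn_expp charp) // muln_gt0 R_gt0.
  rewrite mem_fix_field // -iter_frob (iter_frob_dvd d0 xd ux).
  case: (boolP (d %| r)%N) => //= dr.
  by rewrite -{1}(divnK dr) mulnC orb_poly_dvd.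
rewrite (eq_big_nat _ _ (F2 := fun r => ((d %| r) && (r %/ d <= e))%N : nat)); last first.
  by move=> r /cond ->.
rewrite -big_mkcond sum1_count -size_filter -[RHS](size_iota 1 e) -[RHS](size_map (muln d)).
apply/perm_size/uniq_perm.
- by rewrite filter_uniq // iota_uniq.
- by rewrite map_inj_uniq ?iota_uniq // => i j /eqP; rewrite eqn_pmul2l // => /eqP.
move=> r; rewrite mem_filter mem_index_iota; apply/idP/mapP.
  case/and3P=> /andP[dr re] r0 _; exists (r %/ d)%N; last by rewrite mulnC divnK.
  by rewrite mem_iota divn_gt0 // dvdn_leq //= add1n ltnS.
case=> j; rewrite mem_iota add1n ltnS => /andP[j0 je] ->.
rewrite dvdn_mulr // mulKn // je muln_gt0 d0 j0 /= ltnS.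
by rewrite (leq_trans _ de) // leq_mul2l je orbT.
Qed.

(** This replaces the identity deg g = sum of deg P over the prime powers
    dividing g: each root of g is counted as often as its multiplicity. *)
Lemma sum_orb_poly_dvd m g : g \in monics m ->
  (\sum_(1 <= r < m.+1) count (fun x => (orb_poly r x %| g)%R) (fix_field K (q ^ r))
    = m)%N.
Proof.
move=> gm; have := gm; rewrite mem_monics => /and3P[g1 /eqP sg rg].
have sz : size (rts g) = m by apply: succn_inj; rewrite -size_rts.
rewrite -[RHS]sz -sum_count_undup.
under [RHS]eq_bigr do rewrite -(count_orb_poly_dvd _ gm).
rewrite exchange_big; apply: eq_big_nat => r /andP[r0 _] /=.
rewrite -big_mkcond sum1_count -!size_filter; apply/perm_size/uniq_perm.
- rewrite filter_uniq // /q -expnM (uniq_fix_field charp) // muln_gt0 R_gt0 //.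
- by rewrite filter_uniq ?undup_uniq.
move=> x; rewrite !mem_filter mem_undup; case: (x \in fix_field _ _) => //=; rewrite ?andbF // !andbT.
case: (boolP (_ %| _)) => //= /dvdpP[f gE]; apply/esym.
have : root g x.
  rewrite gE rootM; apply/orP; right; rewrite root_prod_XsubC.
  by case: r r0 {gE} => // r _; rewrite inE eqxx.
by rewrite {1}(rtsE g1) root_prod_XsubC.
Qed.

(** * The L-function and Weil's bound *)

Variable z : algC.
Hypothesis prim_z : p.-primitive_root z.

Lemma abs_trace_mul r (y : K) :
  abs_trace p (R * r) y = abs_trace p R (\sum_(l < r) y ^+ (q ^ l)).
Proof.
elim: r => [|r IH].
  by rewrite muln0 big_ord0 (abs_trace0 charp) /abs_trace big_ord0.
rewrite mulnSr big_ord_recr /= (abs_traceD charp) -IH /abs_trace big_split_ord /=.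
by congr (_ + _); apply: eq_bigr => i _; rewrite -exprM /q -expnM -expnD.
Qed.

(** The trace is a polynomial function of degree q/p, so it has at most q/p
    zeros. *)
Lemma exists_abs_trace_neq0 b : b \in fix_field K q -> b != 0 ->
  exists2 t, t \in fix_field K q & abs_trace p R (b * t) != 0.
Proof.
move=> bE b0; have [/hasP[u uE tu]|/hasPn no] :=
  boolP (has (fun u => abs_trace p R u != 0) (fix_field K q)).
  exists (u / b); last by rewrite mulrC divfK.
  by move: uE bE; rewrite !mem_fix_field // => /eqP uE /eqP bE; rewrite expr_div_n uE bE.
have [R' R'E] : exists R', R = R'.+1 by case: (R) R_gt0 => // R' _; exists R'.
pose T : {poly K} := \sum_(i < R'.+1) 'X ^+ (p ^ i).
have sT : size T = (p ^ R').+1.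
  by rewrite /T (@size_abs_trace_poly _ _ charp 'X 1 R') ?size_polyX // mul1n.
have T0 : T != 0 by rewrite -size_poly_eq0 sT.
have : (size (fix_field K q) < size T)%N.
  apply: max_poly_roots => //; last exact: (uniq_fix_field charp).
  apply/allP => u uE; rewrite rootE /T horner_sum.
  under eq_bigr do rewrite horner_exp hornerX.
  by have := no u uE; rewrite negbK /abs_trace R'E.
rewrite size_fix_field // sT ltnS leqNgt /q R'E expnS.
by rewrite -[X in (X < _)%N]mul1n ltn_pmul2r ?p_gt1 // expn_gt0 p_gt0.
Qed.

Variables (h : {poly K}) (D : nat).
Hypothesis (size_h : size h = D.+1) (D_gt0 : (0 < D)%N) (pD : ~~ (p %| D)%N).
Hypothesis h_rat : rational h.

Lemma horner_frobE x : h.[x] ^+ q = h.[frob x].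
Proof. by rewrite (horner_frob charp) //; apply/rationalP. Qed.

Definition root_sum (s : seq K) := \sum_(x <- s) h.[x].
Definition weight g := add_char p z (abs_trace p R (root_sum (rts g))).
Definition Lcoef m : algC := \sum_(g <- monics m) weight g.

Lemma root_sum_fix g : g \is monic -> rational g ->
  root_sum (rts g) \in fix_field K q.
Proof.
move=> g1 rg; rewrite mem_fix_field // /root_sum (frob_sum charp).
under eq_bigr do rewrite horner_frobE.
by rewrite -(big_map frob predT (fun y => h.[y])) (perm_big _ (perm_frob_rts g1 rg)).
Qed.

Lemma trace_fix x : x \in fix_field K q -> abs_trace p R x \in fix_field K p.
Proof. by move=> xE; apply: (abs_trace_fix charp). Qed.

Lemma weightM g g' : g \is monic -> rational g -> g' \is monic -> rational g' ->
  weight (g * g') = weight g * weight g'.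
Proof.
move=> g1 rg g'1 rg'; rewrite /weight -(add_charD charp prim_z) ?trace_fix ?root_sum_fix //.
rewrite -(abs_traceD charp) /root_sum (perm_big _ (perm_rtsM g1 g'1)).
by rewrite big_cat.
Qed.

(** The trace of h(x) over the field with q elements is the sum of h over the
    conjugates of x. *)
Lemma weight_orb r x : weight (orb_poly r x) = add_char p z (abs_trace p (R * r) h.[x]).
Proof.
rewrite /weight abs_trace_mul; congr (add_char p z (abs_trace p R _)).
rewrite /root_sum (perm_big _ (perm_rts _)); elim: r => [|r IH].
  by rewrite /orb big_nil big_ord0.
rewrite /orb trajectSr -cats1 big_cat big_seq1 IH big_ord_recr /=; congr (_ + _).
elim: r {IH} => [|r IH] /=; first by rewrite expr1.
by rewrite expnSr exprM -IH horner_frobE.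
Qed.

Lemma Lcoef0 : Lcoef 0 = 1.
Proof.
rewrite /Lcoef big_seq1 /weight; have := size_rts (monic1 K).
rewrite size_poly1 => -[/esym/eqP/nilP->]; rewrite /root_sum big_nil.
by rewrite (abs_trace0 charp) (add_char0 charp prim_z).
Qed.

Lemma sum_weight_multiples m r x : (0 < r <= m)%N -> x \in fix_field K (q ^ r) ->
  \sum_(g <- monics m | orb_poly r x %| g) weight g =
  weight (orb_poly r x) * Lcoef (m - r).
Proof.
move=> /andP[r0 rm] xE.
have qr : (1 < q ^ r)%N by rewrite /q -expnM (ltn_expp charp) // muln_gt0 R_gt0.
have xr : x ^+ (q ^ r) = x by move: xE; rewrite mem_fix_field // => /eqP.
have := orb_poly_monics r0 xr; rewrite mem_monics => /and3P[P1 /eqP sP rP].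
set P := orb_poly r x in P1 sP rP *.
rewrite /Lcoef mulr_sumr -big_filter.
rewrite (perm_big (map ( *%R P) (monics (m - r)))) /=; last first.
  apply: uniq_perm.
  - by rewrite filter_uniq // uniq_monics.
  - by rewrite map_inj_uniq ?uniq_monics //; apply/mulfI/monic_neq0.
  move=> g; rewrite mem_filter mem_monics; apply/andP/mapP.
    case=> /dvdpP[f]; rewrite mulrC => gE /and3P[g1 /eqP sg rg]; exists f => //.
    have f1 : f \is monic by rewrite -(monicMl _ P1) -gE.
    rewrite mem_monics f1 /=; apply/andP; split.
      move: sg; rewrite gE size_proper_mul; last first.
        by rewrite (monicP P1) (monicP f1) mulr1 oner_neq0.
      rewrite sP addSn /= => sg; have : (r + size f = r + (m - r).+1)%N.
        by rewrite addnS subnKC.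
      by move/addnI/eqP.
    by apply: (rational_divl P1 rP); rewrite -gE.
  case=> f; rewrite mem_monics => /and3P[f1 /eqP sf rf] ->.
  split; first exact: dvdp_mulr.
  rewrite monicMl // f1 rationalM // andbT size_proper_mul ?sP ?sf.
    by rewrite addSn addnS subnKC ?eqxx.
  by rewrite (monicP P1) (monicP f1) mulr1 oner_neq0.
rewrite big_map; apply: eq_big_seq => f.
by rewrite mem_monics => /and3P[f1 _ rf]; rewrite weightM.
Qed.

(** The coefficients of T L'(T) = L(T) (S_1 T + S_2 T^2 + ...) where L has
    coefficients [Lcoef] and S_r is the character sum over the extension of
    degree r. *)
Lemma Lcoef_rec m :
  \sum_(1 <= r < m.+1) char_sum p z (R * r) h * Lcoef (m - r) = m%:R * Lcoef m.
Proof.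
rewrite {2}/Lcoef mulr_sumr.
transitivity (\sum_(g <- monics m) \sum_(1 <= r < m.+1)
   \sum_(x <- fix_field K (q ^ r) | orb_poly r x %| g) weight g); last first.
  apply: eq_big_seq => g gm; rewrite -{2}(sum_orb_poly_dvd gm) natr_sum mulr_suml.
  by apply: eq_bigr => r _; rewrite big_const_seq iter_addr_0 mulr_natl.
rewrite exchange_big; apply: eq_big_nat => r /andP[r0 rm] /=.
rewrite (exchange_big_dep predT) //= /char_sum expnM mulr_suml.
apply: eq_big_seq => x xE; rewrite sum_weight_multiples ?r0 //.
by rewrite weight_orb.
Qed.

Lemma shift_monics m t g : (D <= m)%N -> t \in fix_field K q ->
  g \in monics m -> g + t *: 'X^(m - D) \in monics m.
Proof.
move=> Dm tE; rewrite !mem_monics => /and3P[g1 /eqP sg rg].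
have lt : (size (t *: 'X^(m - D)) < size g)%N.
  rewrite (leq_ltn_trans (size_scale_leq _ _)) // size_polyXn sg.
  by move: D_gt0 Dm; lia.
rewrite qualifE /= lead_coefDl // -[_ == 1]/(g \is monic) g1 size_polyDl // sg eqxx /=.
apply: rationalD => //; apply/rationalP => i; rewrite coefZ coefXn.
case: (i == _); last by rewrite mulr0 expr0n expn_eq0 gtn_eqF.
by rewrite mulr1; move: tE; rewrite mem_fix_field // => /eqP.
Qed.

Lemma root_sum_psum s : root_sum s = \sum_(j < D.+1) h`_j * psum s j.
Proof.
rewrite /root_sum /psum; under [RHS]eq_bigr do rewrite mulr_sumr.
by rewrite exchange_big; apply: eq_bigr => x _; rewrite horner_coef size_h.
Qed.

(** The reciprocal polynomial changes first in degree D, so the power sums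
    p_1, ..., p_(D-1) of the roots are kept and p_D changes by - D t. *)
Lemma weight_shift m t g : (D <= m)%N -> t \in fix_field K q -> g \in monics m ->
  weight (g + t *: 'X^(m - D)) =
  weight g * add_char p z (abs_trace p R (- (h`_D * D%:R) * t)).
Proof.
move=> Dm tE gm; have g'm := shift_monics Dm tE gm.
set g' := g + _ in g'm *.
have := gm; have := g'm; rewrite !mem_monics => /and3P[g'1 /eqP sg' rg'] /and3P[g1 /eqP sg rg].
have ss : size (rts g) = m by apply: succn_inj; rewrite -size_rts.
have ss' : size (rts g') = m by apply: succn_inj; rewrite -size_rts.
have e i : (i <= m)%N -> (revprod (rts g))`_i = g`_(m - i).
  by move=> im; rewrite -coef_revprod ss // -rtsE.
have e' i : (i <= m)%N -> (revprod (rts g'))`_i = g'`_(m - i).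
  by move=> im; rewrite -coef_revprod ss' // -rtsE.
have [|eqp pD'] := @newton_shift _ (rts g) (rts g') D D_gt0.
  move=> i iD; rewrite e ?e' ?(leq_trans _ Dm) ?(ltnW iD) // /g' coefD coefZ coefXn.
  by rewrite (_ : (m - i == m - D)%N = false) ?mulr0 ?addr0 //; move: iD Dm; lia.
rewrite e // e' // /g' coefD coefZ coefXn eqxx mulr1 addrAC subrr add0r in pD'.
have rs : root_sum (rts g') = root_sum (rts g) + - (h`_D * D%:R) * t.
  rewrite !root_sum_psum !big_ord_recr /= pD'.
  rewrite (eq_bigr (fun j : 'I_D => h`_j * psum (rts g) j)); first by ring.
  move=> [[|j] jD] _ /=; last by rewrite eqp.
  by rewrite /psum !big_const_seq !count_predT ss ss'.
rewrite /weight rs (abs_traceD charp) (add_charD charp prim_z) ?trace_fix ?root_sum_fix //.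
have := root_sum_fix g'1 rg'; have := root_sum_fix g1 rg; rewrite !mem_fixq => /eqP E /eqP E'.
have -> : - (h`_D * D%:R) * t = root_sum (rts g') - root_sum (rts g) by rewrite rs addrC addKr.
by rewrite rmorphB /= E E'.
Qed.

(** A translation of the set of monic polynomials multiplies the sum of the
    weights by a root of unity other than 1. *)
Lemma Lcoef_vanish m : (D <= m)%N -> Lcoef m = 0.
Proof.
move=> Dm; set b := - (h`_D * D%:R).
have D0 : D%:R != 0 :> K by rewrite -(dvdn_pcharf charp).
have b0 : b != 0.
  rewrite oppr_eq0 mulf_neq0 // -[D]/(D.+1.-1) -size_h -lead_coefE lead_coef_eq0.
  by rewrite -size_poly_eq0 size_h.
have bE : b \in fix_field K q.
  rewrite mem_fixq /b rmorphN rmorphM rmorph_nat /=.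
  by move/rationalP: h_rat => /(_ D) E; rewrite {1}/frob E.
have [t tE tb] := exists_abs_trace_neq0 bE b0.
have btE : b * t \in fix_field K q.
  by move: bE tE; rewrite !mem_fixq rmorphM /= => /eqP-> /eqP->.
have ne := add_char_neq1 charp prim_z (trace_fix btE) tb.
have : Lcoef m = Lcoef m * add_char p z (abs_trace p R (b * t)).
  rewrite {1}/Lcoef (perm_big (map (fun g => g + t *: 'X^(m - D)) (monics m))) /=.
    rewrite big_map /Lcoef mulr_suml; apply: eq_big_seq => g gm.
    by rewrite weight_shift.
  apply: uniq_perm; rewrite ?uniq_monics //.
    by rewrite map_inj_uniq ?uniq_monics //; apply: addIr.
  move=> g; apply/idP/mapP => [gm|[f fm ->]]; last exact: shift_monics.
  exists (g - t *: 'X^(m - D)); last by rewrite subrK.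
  rewrite -scaleNr shift_monics // mem_fixq rmorphN /=.
  by move: tE; rewrite mem_fixq => /eqP->.
move/eqP; rewrite -subr_eq0 -{1}[Lcoef m]mulr1 -mulrBr mulf_eq0 => /orP[/eqP//|].
by rewrite subr_eq0 eq_sym (negPf ne).
Qed.

(** The w are the inverse roots of the L-function, completed by zeros if its
    degree is less than D - 1.  Stepanov's bound concerns the extensions of even degree, and so the squares of the w. *)
Theorem weil_bound : `|char_sum p z R h| <= (D - 1)%:R * sqrtC q%:R.
Proof.
pose P : {poly algC} := \poly_(j < D) Lcoef (D.-1 - j).
have PD : P`_D.-1 = 1 by rewrite coef_poly prednK // leqnn subnn Lcoef0.
have sP : size P = D.
  by rewrite size_poly_eq // subnn Lcoef0 oner_neq0.
have P1 : P \is monic by rewrite qualifE /= lead_coefE sP PD.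
have [w] := closed_field_poly_normal P; rewrite (monicP P1) scale1r => Pw.
have sw : size w = D.-1 by have := sP; rewrite Pw size_prod_XsubC => <-.
have wL i : (revprod w)`_i = Lcoef i.
  have [iD|Di] := ltnP i D.
    have iD' : (i <= D.-1)%N by rewrite -ltnS prednK.
    rewrite -coef_revprod ?sw // -Pw coef_poly subKn //.
    by rewrite (leq_ltn_trans (leq_subr _ _)) // prednK.
  by rewrite Lcoef_vanish // nth_default // (leq_trans (size_revprod _)) // sw prednK.
have Sw r : (0 < r)%N -> char_sum p z (R * r) h = - psum w r.
  apply: (newton_uniq (u := fun r => char_sum p z (R * r) h)
    (u' := fun r => - psum w r) Lcoef0) => j; rewrite Lcoef_rec -wL newton -sumrN.
  by apply: eq_bigr => i _; rewrite mulNr wL.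
pose w2 := map (fun x => x ^+ 2) w.
have w2b : forall y, y \in w2 -> `|y| <= q%:R.
  apply: (@psum_bound _ _ (2 * p * (2 * D + 2))%:R); first by rewrite ltr0n ltnW.
  move=> m; have -> : psum w2 m.+1 = - char_sum p z (R * (m.+1 + m.+1)) h.
    rewrite Sw // opprK /psum big_map; apply: eq_bigr => x _.
    by rewrite -exprM mul2n addnn.
  have Rm : (0 < R * m.+1)%N by rewrite muln_gt0 R_gt0.
  have -> : (R * (m.+1 + m.+1) = (R * m.+1).-1.+1 + (R * m.+1).-1.+1)%N.
    by rewrite !prednK // mulnDr.
  rewrite normrN -natrX -expnM -[in X in _ <= X](prednK Rm).
  apply: (char_sum_even charp prim_z size_h) => // i.
  rewrite !prednK // -mulnDr; move: (m.+1 + m.+1)%N => r.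
  have E : frob h`_i = h`_i by apply/rationalP.
  by rewrite expnM -iter_frob; elim: r => //= r ->.
have wb x : x \in w -> `|x| <= sqrtC q%:R.
  move=> xw; rewrite -(ler_pXn2r (isT : 0 < 2)%N) ?nnegrE ?sqrtC_ge0 ?ler0n //.
  by rewrite sqrtCK -normrX w2b //; apply/mapP; exists x.
have -> : char_sum p z R h = - psum w 1 by rewrite -Sw // muln1.
rewrite normrN subn1 -sw /psum (le_trans (ler_norm_sum _ _ _)) //.
rewrite -sum1_size natr_sum mulr_suml big_seq [X in _ <= X]big_seq.
by apply: ler_sum => x xw; rewrite mul1r expr1 wb.
Qed.

End Lfunction.

(** * Algebraic and arithmetic preliminaries *)

Lemma irr_root_dvd (F L : fieldType) (j : {rmorphism F -> L}) (f g : {poly F}) x :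
  irreducible_poly f -> root (map_poly j f) x -> root (map_poly j g) x -> f %| g.
Proof.
move=> irr fx gx; apply: contraLR isT => nfg.
have : coprimep (map_poly j f) (map_poly j g).
  by rewrite coprimep_map irreducible_poly_coprime.
by move/coprimep_root => /(_ x fx); rewrite (rootP gx) eqxx.
Qed.

Lemma root_map_dvd (F L : fieldType) (j : {rmorphism F -> L}) (f g : {poly F}) x :
  f %| g -> root (map_poly j f) x -> root (map_poly j g) x.
Proof. by case/dvdpP => h ->; rewrite rmorphM rootM => ->; rewrite orbT. Qed.

Lemma expf_coprime_eq1 (R : nzRingType) (x : R) a b : coprime a b -> (0 < a)%N ->
  x ^+ a = 1 -> x ^+ b = 1 -> x = 1.
Proof.
move=> /eqP ab a0 xa xb; have [u' v' E _] := egcdnP b a0.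
have := congr1 (fun m => x ^+ m) E; rewrite /= ab exprD expr1.
by rewrite mulnC exprM xa expr1n mulnC exprM xb expr1n mul1r.
Qed.

Lemma prod_primes_dvd m : (0 < m)%N -> (\prod_(l <- primes m) l %| m)%N.
Proof.
move=> m0; rewrite {2}(prod_prime_decomp m0) /primes big_map.
rewrite [X in (X %| _)%N]big_seq [X in (_ %| X)%N]big_seq.
apply: (big_ind2 (fun a b => a %| b)%N) => // [a b c e ab ce|[l e] /= le].
  exact: dvdn_mul.
by have [_ e0 _] := mem_prime_decomp le; rewrite -{1}[l]expn1 dvdn_exp2l.
Qed.

Lemma prod_prime_factor_ge ps : all prime ps ->
  (2 ^ size ps)%:R^-1 <= \prod_(l <- ps) (1 - l%:R^-1) :> algC.
Proof.
elim: ps => [|l ps IH] /=; first by rewrite big_nil expn0 invr1.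
case/andP=> /prime_gt1 l1 /IH {}IH; rewrite big_cons expnS natrM invfM.
apply: ler_pM => //; rewrite ?invr_ge0 ?ler0n //.
have l2 : (l%:R^-1 : algC) <= 2^-1.
  by rewrite lef_pV2 ?posrE ?ltr0n // ?ler_nat // ltnW.
have -> : 2^-1 = 1 - 2^-1 :> algC by field.
by rewrite lerD2l lerN2.
Qed.

(** A prime factor l >= 2^t accounts for a factor 2^t of the left-hand side by
    itself, and there are fewer than 2^t smaller ones. *)
Lemma exp2_omega_bound t N : (0 < N)%N ->
  ((2 ^ size (primes N)) ^ t <= 2 ^ (t * 2 ^ t) * N)%N.
Proof.
move=> N0; set B := (2 ^ t)%N; have B0 : (0 < B)%N by rewrite expn_gt0.
have -> : ((2 ^ size (primes N)) ^ t = \prod_(l <- primes N) B)%N.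
  by rewrite big_const_seq count_predT iter_muln_1 -!expnM mulnC.
apply: (@leq_trans (\prod_(l <- primes N) ((if l < B then B else 1) * l))%N).
  rewrite big_seq [X in (_ <= X)%N]big_seq; apply: leq_prod => l.
  rewrite mem_primes => /andP[/prime_gt0 l0 _].
  by case: ltnP => Bl; rewrite ?mul1n // leq_pmulr.
rewrite big_split leq_mul //=; last by rewrite dvdn_leq // prod_primes_dvd.
rewrite -big_mkcond big_const_seq iter_muln_1 expnM leq_pexp2l //.
rewrite -size_filter -[X in (_ <= X)%N](size_iota 0 B).
apply: uniq_leq_size; first by rewrite filter_uniq // primes_uniq.
by move=> l; rewrite mem_filter mem_iota add0n => /andP[].
Qed.

(** * Primitive polynomials from primitive elements *)

Section PrescribedTraces.
Variables (K : closedFieldType) (p : nat).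
Hypothesis charp : p \in [pchar K].
Variables (R n : nat).
Hypotheses (R_gt0 : (0 < R)%N) (n_gt0 : (0 < n)%N).
Variables (F : finFieldType) (iota_F : {rmorphism F -> K}).
Hypothesis cardF : #|F| = (p ^ R)%N.

Let p_pr : prime p := pcharf_prime charp.
Let p_gt0 := prime_gt0 p_pr.
Let p_gt1 := prime_gt1 p_pr.
Let q := (p ^ R)%N.
Let Q := (q ^ n)%N.
Let Rn_gt0 : (0 < R * n)%N. Proof. by rewrite muln_gt0 R_gt0. Qed.
Let QE : Q = (p ^ (R * n))%N. Proof. by rewrite /Q /q expnM. Qed.
Let q_gt1 : (1 < q)%N. Proof. exact: (ltn_expp charp). Qed.
Let Q_gt1 : (1 < Q)%N. Proof. by rewrite QE (ltn_expp charp). Qed.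

Let N := Q.-1.
Let N_gt0 : (0 < N)%N. Proof. by rewrite /N -subn1 subn_gt0. Qed.

Lemma perm_iota_fix : perm_eq (map iota_F (enum F)) (fix_field K q).
Proof.
have u : uniq (map iota_F (enum F)) by rewrite map_inj_uniq ?enum_uniq //; apply: fmorph_inj.
have sub : {subset map iota_F (enum F) <= fix_field K q}.
  move=> x /mapP[a _ ->]; rewrite mem_fix_field // -rmorphXn /= /q -cardF.
  by rewrite expf_card.
have ss : (size (fix_field K q) <= size (map iota_F (enum F)))%N.
  by rewrite size_fix_field // size_map -cardE cardF.
by apply: uniq_perm; rewrite ?(uniq_fix_field charp) //; case: (uniq_min_size u sub ss).
Qed.

Lemma mem_iota_fix a : iota_F a \in fix_field K q.
Proof. by rewrite -(perm_mem perm_iota_fix) map_f // mem_enum. Qed.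

Lemma fix_iotaP x : x \in fix_field K q -> exists a, x = iota_F a.
Proof. by rewrite -(perm_mem perm_iota_fix) => /mapP[a _ ->]; exists a. Qed.

Lemma fix_fieldD x y : x \in fix_field K q -> y \in fix_field K q ->
  x + y \in fix_field K q.
Proof. by move=> /fix_iotaP[a ->] /fix_iotaP[b ->]; rewrite -rmorphD mem_iota_fix. Qed.

Lemma fix_fieldM x y : x \in fix_field K q -> y \in fix_field K q ->
  x * y \in fix_field K q.
Proof. by move=> /fix_iotaP[a ->] /fix_iotaP[b ->]; rewrite -rmorphM mem_iota_fix. Qed.

Lemma fix_fieldN x : x \in fix_field K q -> - x \in fix_field K q.
Proof. by move=> /fix_iotaP[a ->]; rewrite -rmorphN mem_iota_fix. Qed.

Lemma fix_field_sum (I : Type) (s : seq I) (f : I -> K) :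
  (forall i, f i \in fix_field K q) -> \sum_(i <- s) f i \in fix_field K q.
Proof.
move=> fE; elim: s => [|i s IH]; last by rewrite big_cons fix_fieldD.
by rewrite big_nil -(rmorph0 iota_F) mem_iota_fix.
Qed.

Lemma descend (P : {poly K}) : rational p R P -> exists f, map_poly iota_F f = P.
Proof.
move=> /(rationalP charp) PE.
have ex i : exists a, P`_i == iota_F a.
  have /fix_iotaP[a ->] : P`_i \in fix_field K q by rewrite mem_fix_field // PE.
  by exists a.
exists (\poly_(i < size P) xchoose (ex i)); apply/polyP => i.
rewrite coef_map coef_poly /=; case: ltnP => [_|Pi]; last by rewrite rmorph0 nth_default.
by rewrite /= -(eqP (xchooseP (ex i))).
Qed.

(** The conjugates of x are distinct: x^(q^d) = x with 0 < d < n would give x an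
    order dividing q^d - 1 < N.  A factor of f over F which has one of them as a
    root has them all, whence irreducibility.  A root y of f in any extension
    satisfies the same equations y^i = 1 as x, for f divides X^i - 1 as soon as
    one of its roots is a root of X^i - 1. *)
Lemma primitive_minpoly x : N.-primitive_root x ->
  exists f : {poly F}, [/\ primitive_polynomial f, size f = n.+1
    & map_poly iota_F f = orb_poly p R n x].
Proof.
move=> xprim.
have xQ : x ^+ Q = x.
  by rewrite -(prednK (ltnW Q_gt1)) exprS -/N (prim_expr_order xprim) mulr1.
have := orb_poly_monics charp R_gt0 n_gt0 xQ.
rewrite (mem_monics charp R_gt0) => /and3P[P1 /eqP sP rP].
have [f fE] := descend rP.
have sf : size f = n.+1 by rewrite -sP -fE size_map_poly.
have f1 : f \is monic by move: P1; rewrite -fE map_monic.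
have x0 : x != 0.
  apply: contraTneq (oner_neq0 K) => x0; rewrite -(prim_expr_order xprim) x0.
  by rewrite expr0n gtn_eqF // eqxx.
have uo : uniq (orb p R n x).
  rewrite /orb; case: n n_gt0 (xprim : ((q ^ n).-1).-primitive_root x) => // m _ xp.
  rewrite looping_uniq; apply/negP => /trajectP[i im].
  move/(iter_frob_cancel charp (ltnW im)); rewrite (iter_frob p R) -/q.
  set d := (m - i)%N => xd.
  have d0 : (0 < d)%N by rewrite subn_gt0.
  have qd1 : (0 < q ^ d)%N by rewrite expn_gt0 ltnW.
  have : x ^+ (q ^ d).-1 == 1.
    by rewrite -(inj_eq (mulfI x0)) -exprS prednK // xd mulr1.
  rewrite -(prim_order_dvd xp) => /dvdn_leq.
  have qdm : (q ^ d < q ^ m.+1)%N by rewrite ltn_exp2l // ltnS leq_subr.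
  have qd2 : (1 < q ^ d)%N by rewrite -(expn0 q) ltn_exp2l.
  move: qd2 qdm; move: (q ^ d)%N (q ^ m.+1)%N => a b; lia.
have irr : irreducible_poly f.
  split; first by rewrite sf ltnS.
  move=> g sg gf.
  have [y gy] : exists y, root (map_poly iota_F g) y.
    by apply/closed_rootP; rewrite size_map_poly.
  have itg i w : root (map_poly iota_F g) w -> root (map_poly iota_F g) (iter i (frob p R) w).
    move=> gw; elim: i => //= i; rewrite !rootE /frob => /eqP gi.
    have gr l : (map_poly iota_F g)`_l ^+ (p ^ R) = (map_poly iota_F g)`_l.
      by have := mem_iota_fix g`_l; rewrite coef_map mem_fix_field // => /eqP.
    by rewrite -(horner_frob charp) // gi expr0n expn_eq0 gtn_eqF.
  have := root_map_dvd gf gy.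
  rewrite fE root_prod_XsubC => /trajectP[i im yE].
  have gx : root (map_poly iota_F g) x.
    have := itg (n - i)%N y gy; rewrite yE -iterD subnK ?(ltnW im) //.
    by rewrite (iter_frob p R) xQ.
  have : orb_poly p R n x %| map_poly iota_F g.
    apply: uniq_roots_dvdp; last by rewrite uniq_rootsE.
    by apply/allP => w /trajectP[l _ ->]; apply: itg.
  by rewrite -fE dvdp_map => fg; rewrite /eqp gf.
have fx : root (map_poly iota_F f) x.
  rewrite fE root_prod_XsubC; case: (n) n_gt0 => // m _.
  by rewrite /orb inE eqxx.
exists f; split=> //; split=> // L y fy.
rewrite sf /= cardF -/q -/Q -/N.
have tr i : (y ^+ i == 1) = (x ^+ i == 1).
  have tst (L' : fieldType) (j : {rmorphism F -> L'}) w :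
      (w ^+ i == 1) = root (map_poly j ('X^i - 1)) w.
    by rewrite rmorphB rmorph1 /= map_polyXn rootE !hornerE subr_eq0.
  rewrite (tst _ (in_alg L)) (tst _ iota_F); apply/idP/idP => H.
    exact: root_map_dvd (irr_root_dvd irr fy H) fx.
  exact: root_map_dvd (irr_root_dvd irr fx H) fy.
have := xprim; rewrite /primitive_root_of_unity => /andP[-> /forallP all_i].
by apply/forallP => i; have := all_i i; rewrite !unity_rootE tr.
Qed.

(** * Counting the powers with prescribed traces *)

Variable z : algC.
Hypothesis prim_z : p.-primitive_root z.

Definition psi (x : K) : algC := add_char p z (abs_trace p R x).

Lemma psiD x y : x \in fix_field K q -> y \in fix_field K q ->
  psi (x + y) = psi x * psi y.
Proof.
move=> xE yE; rewrite /psi (abs_traceD charp) (add_charD charp prim_z) //;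
  exact: (abs_trace_fix charp).
Qed.

Lemma psi0 : psi 0 = 1.
Proof. by rewrite /psi (abs_trace0 charp) (add_char0 charp prim_z). Qed.

Lemma psi_sum (I : Type) (s : seq I) (f : I -> K) :
  (forall i, f i \in fix_field K q) -> psi (\sum_(i <- s) f i) = \prod_(i <- s) psi (f i).
Proof.
move=> fE; elim: s => [|i s IH]; first by rewrite !big_nil psi0.
by rewrite !big_cons psiD ?fix_field_sum // IH.
Qed.

Lemma psi_orthogonal w : w \in fix_field K q ->
  \sum_(a : F) psi (iota_F a * w) = if w == 0 then q%:R else 0.
Proof.
move=> wE; case: eqP => [->|/eqP w0].
  under eq_bigr do rewrite mulr0 psi0.
  by rewrite sumr_const cardF.
have [_ /fix_iotaP[b ->] tb] := exists_abs_trace_neq0 charp R_gt0 wE w0.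
have wbE : w * iota_F b \in fix_field K q by rewrite fix_fieldM ?mem_iota_fix.
have ne := add_char_neq1 charp prim_z (abs_trace_fix charp wbE R_gt0) tb.
set S := \sum_a _.
have : S = S * psi (w * iota_F b).
  rewrite /S {1}(reindex_inj (addIr b)) mulr_suml; apply: eq_bigr => a _ /=.
  by rewrite rmorphD mulrDl [iota_F b * w]mulrC psiD // fix_fieldM ?mem_iota_fix.
move/eqP; rewrite -subr_eq0 -{1}[S]mulr1 -mulrBr mulf_eq0 => /orP[/eqP//|].
by rewrite subr_eq0 eq_sym (negPf ne).
Qed.

(** The product over j of the orthogonality relations. *)
Lemma psi_indicator k (w : 'I_k -> K) : (forall j, w j \in fix_field K q) ->
  \sum_(a : {ffun 'I_k -> F}) psi (\sum_j iota_F (a j) * w j) =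
  (q ^ k * [forall j, w j == 0])%:R.
Proof.
move=> wE.
rewrite (eq_bigr (fun a : {ffun _} => \prod_j psi (iota_F (a j) * w j))); last first.
  by move=> a _; rewrite psi_sum // => j; rewrite fix_fieldM ?mem_iota_fix.
rewrite -(bigA_distr_bigA (fun j a => psi (iota_F a * w j))) /=.
under eq_bigr do rewrite psi_orthogonal //.
case: forallP => [w0|nw].
  under eq_bigr do rewrite w0.
  by rewrite prodr_const card_ord muln1 natrX.
rewrite muln0; have [/forallP//|] := boolP [forall j, w j == 0].
by rewrite negb_forall => /existsP[j /negPf wj]; rewrite (bigD1 j) //= wj mul0r.
Qed.

Lemma fix_fieldX y m : y \in fix_field K Q -> y ^+ m \in fix_field K Q.
Proof. by rewrite !mem_fix_field // exprAC => /eqP->. Qed.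

Definition rel_trace (y : K) : K := \sum_(l < n) y ^+ (q ^ l).

Lemma rel_trace_sum (I : Type) (s : seq I) (f : I -> K) :
  rel_trace (\sum_(i <- s) f i) = \sum_(i <- s) rel_trace (f i).
Proof.
rewrite /rel_trace exchange_big; apply: eq_bigr => l _ /=.
by rewrite /q -expnM (frob_sum charp).
Qed.

Lemma rel_traceZ a y : rel_trace (iota_F a * y) = iota_F a * rel_trace y.
Proof.
rewrite /rel_trace mulr_sumr; apply: eq_bigr => l _; rewrite exprMn; congr (_ * _).
have := mem_iota_fix a; rewrite mem_fix_field // => /eqP aE.
by elim: (l : nat) => [|i IH]; rewrite ?expr1 // expnSr exprM IH.
Qed.

Lemma rel_trace_fix y : y \in fix_field K Q -> rel_trace y \in fix_field K q.
Proof.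
rewrite !mem_fix_field // => /eqP yE; rewrite /rel_trace (frob_sum charp).
rewrite /Q in yE; case: (n) n_gt0 yE => // m _ yE.
rewrite big_ord_recr big_ord_recl /= addrC -exprM -expnSr yE expn0 expr1.
by apply/eqP; congr (_ + _); apply: eq_bigr => i _; rewrite -exprM -expnSr.
Qed.

Variables (k : nat) (u : 'I_k -> K).
Hypotheses (k_gt0 : (0 < k)%N) (kp : (k < p)%N).
Hypothesis uE : forall j, u j \in fix_field K q.

Definition traces_ok x := [forall j : 'I_k, rel_trace (x ^+ j.+1) == u j].

Definition coeff_poly (a : {ffun 'I_k -> F}) : {poly K} :=
  \sum_j iota_F (a j) *: 'X^(j.+1).

Lemma coef_coeff_poly a i : (coeff_poly a)`_i =
  if i is i'.+1 then (if insub i' is Some j then iota_F (a j) else 0) else 0.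
Proof.
rewrite coef_sum; case: i => [|i].
  by apply: big1 => j _; rewrite coefZ coefXn mulr0.
case: insubP => [j _ ji|]; last first.
  rewrite -leqNgt => ki; apply: big1 => j _; rewrite coefZ coefXn eqSS.
  by rewrite gtn_eqF ?mulr0 // (leq_trans (ltn_ord j)).
rewrite (bigD1 j) //= coefZ coefXn -ji eqxx mulr1 big1 ?addr0 // => j' jj'.
by rewrite coefZ coefXn eqSS eq_sym (inj_eq val_inj) (negPf jj') mulr0.
Qed.

Lemma fix_field_sub x : x \in fix_field K q -> x ^+ Q = x.
Proof.
rewrite mem_fix_field // => /eqP xE; rewrite /Q.
by elim: (n) => [|i IH]; rewrite ?expr1 // expnSr exprM IH.
Qed.

(** The degree is d times that of [coeff_poly a], hence prime to p: the
    latter lies between 1 and k < p, and d divides Q - 1. *)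
Lemma char_sum_coeff_poly d a : (d %| Q.-1)%N -> a != 0 ->
  `|char_sum p z (R * n) (coeff_poly a \Po 'X^d)| <= (d * k - 1)%:R * sqrtC Q%:R.
Proof.
move=> dN a0; set f := coeff_poly a.
have d0 : (0 < d)%N by apply: dvdn_gt0 dN; rewrite -subn1 subn_gt0.
have f0 : f != 0.
  apply: contra a0 => /eqP f0; apply/eqP/ffunP => j; rewrite ffunE.
  have : f`_(j.+1) = 0 by rewrite f0 coef0.
  by rewrite coef_coeff_poly valK => /eqP; rewrite fmorph_eq0 => /eqP.
have sfk : (size f <= k.+1)%N.
  apply/leq_sizeP => -[|i] //; rewrite ltnS => ki; rewrite coef_coeff_poly.
  by case: insubP => // j ik; rewrite leqNgt ik in ki.
have sf1 : (1 < size f)%N.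
  rewrite ltnNge; apply/negP => /size1_polyC fE; case/negP: f0.
  by rewrite fE coef_coeff_poly.
set D0 := (size f).-1.
have D00 : (0 < D0)%N by rewrite /D0 -subn1 subn_gt0.
have D0k : (D0 <= k)%N by rewrite /D0 -ltnS prednK // ltnW.
have sh : size (f \Po 'X^d) = (D0 * d).+1.
  have := size_comp_poly f 'X^d; rewrite size_polyXn /= -/D0 => <-.
  by rewrite prednK // size_poly_gt0 comp_poly_eq0 // size_polyXn ltnS.
have pD : ~~ (p %| D0 * d)%N.
  rewrite Euclid_dvdM // negb_or; apply/andP; split.
    by rewrite gtnNdvd // (leq_ltn_trans D0k).
  have pQ : (p %| Q)%N by rewrite QE dvdn_exp.
  apply/negP => /dvdn_trans/(_ dN).
  by rewrite -subn1 dvdn_subr ?(ltnW Q_gt1) // dvdn1 gtn_eqF.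
have rat : rational p (R * n) (f \Po 'X^d).
  apply/(rationalP charp) => i; rewrite -QE coef_comp_poly.
  have -> : \sum_(j < size f) f`_j * ('X^d ^+ j)`_i =
            \sum_(j < size f) f`_j * (i == d * j)%N%:R.
    by apply: eq_bigr => j _; rewrite -exprM coefXn.
  apply: fix_field_sub; apply: fix_field_sum => j; apply: fix_fieldM.
    rewrite coef_coeff_poly; case: (j : nat) => [|j']; last case: insubP => [? _ _|_];
      rewrite ?mem_iota_fix // -(rmorph0 iota_F) mem_iota_fix //.
  by rewrite -(rmorph_nat iota_F) mem_iota_fix.
have D_gt0 : (0 < D0 * d)%N by rewrite muln_gt0 D00.
have := weil_bound charp Rn_gt0 prim_z sh D_gt0 pD rat; rewrite -QE => /le_trans; apply.
by rewrite ler_wpM2r ?sqrtC_ge0 ?ler0n // ler_nat leq_sub2r // mulnC leq_mul2l D0k orbT.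
Qed.

(** Expand the indicator of the prescribed traces in characters; a = 0 gives the
    main term Q. *)
Lemma count_traces_power d : (d %| Q.-1)%N ->
  `|(q ^ k * count (fun y => traces_ok (y ^+ d)) (fix_field K Q))%:R - Q%:R|
    <= (q ^ k * (d * k - 1))%:R * sqrtC Q%:R :> algC.
Proof.
move=> dN.
pose c (a : {ffun 'I_k -> F}) := psi (\sum_j iota_F (a j) * - u j).
have EE : (q ^ k * count (fun y => traces_ok (y ^+ d)) (fix_field K Q))%:R =
  \sum_(a : {ffun 'I_k -> F}) c a * char_sum p z (R * n) (coeff_poly a \Po 'X^d).
  transitivity (\sum_(y <- fix_field K Q) \sum_(a : {ffun 'I_k -> F})
     psi (\sum_j iota_F (a j) * (rel_trace ((y ^+ d) ^+ j.+1) - u j))).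
    rewrite -sum1_count natrM natr_sum mulr_sumr big_mkcond.
    apply: eq_big_seq => y yE; rewrite psi_indicator => [|j].
      rewrite /traces_ok; under [in RHS]eq_forallb do rewrite subr_eq0.
      by case: forallP => _; rewrite ?muln1 ?mulr1 ?muln0.
    by rewrite fix_fieldD ?fix_fieldN // rel_trace_fix // !fix_fieldX.
  rewrite exchange_big; apply: eq_bigr => a _ /=.
  rewrite /char_sum -QE mulr_sumr; apply: eq_big_seq => y yE.
  have trE j : rel_trace ((y ^+ d) ^+ j.+1) \in fix_field K q.
    by rewrite rel_trace_fix // !fix_fieldX.
  rewrite (abs_trace_mul charp) -/(rel_trace _) horner_comp hornerXn.
  rewrite /coeff_poly horner_sum rel_trace_sum mulrC -psiD; first last.
  - by apply: fix_field_sum => j; rewrite fix_fieldM ?mem_iota_fix ?fix_fieldN.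
  - by apply: fix_field_sum => j; rewrite hornerZ hornerXn rel_traceZ fix_fieldM ?mem_iota_fix.
  congr (psi _); rewrite -big_split; apply: eq_bigr => j _ /=.
  by rewrite hornerZ hornerXn rel_traceZ mulrDr.
rewrite EE (bigD1 (0 : {ffun 'I_k -> F})) //= {1}/c.
rewrite big1 ?psi0 ?mul1r => [|j _]; last by rewrite ffunE rmorph0 mul0r.
have -> : char_sum p z (R * n) (coeff_poly 0 \Po 'X^d) = Q%:R.
  rewrite /char_sum -QE (eq_bigr (fun=> 1)) => [|y _].
    by rewrite big_const_seq count_predT size_fix_field // iter_addr_0.
  rewrite (_ : coeff_poly 0 = 0) ?comp_poly0 ?horner0; last first.
    by apply: big1 => j _; rewrite ffunE rmorph0 scale0r.
  by rewrite (abs_trace0 charp) (add_char0 charp prim_z).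
rewrite addrC addrK (le_trans (ler_norm_sum _ _ _)) //.
apply: (@le_trans _ _ (\sum_(a : {ffun 'I_k -> F} | a != 0) (d * k - 1)%:R * sqrtC Q%:R)).
  apply: ler_sum => a a0; rewrite normrM /c (norm_add_char charp prim_z) mul1r.
  exact: char_sum_coeff_poly.
rewrite sumr_const -[X in X <= _]mulr_natl mulrA -natrM.
rewrite ler_wpM2r ?sqrtC_ge0 ?ler0n // ler_nat leq_mul2r; apply/orP; right.
rewrite (leq_trans (max_card _)) // card_ffun card_ord cardF //.
Qed.

(** * The sieve *)

Definition fix_units : seq K := [seq x <- fix_field K Q | x != 0].

Lemma uniq_fix_units : uniq fix_units.
Proof. by rewrite filter_uniq // QE (uniq_fix_field charp). Qed.

Lemma size_fix_units : size fix_units = N.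
Proof.
have uQ : uniq (fix_field K Q) by rewrite QE (uniq_fix_field charp).
have E0 : 0 \in fix_field K Q by rewrite mem_fix_field // expr0n gtn_eqF // ltnW.
have := count_predC (pred1 0) (fix_field K Q).
by rewrite (count_uniq_mem _ uQ) E0 size_fix_field // size_filter /N => {2}<-.
Qed.

Lemma mem_fix_units x : (x \in fix_units) = (x != 0) && (x ^+ N == 1).
Proof.
rewrite mem_filter mem_fix_field //; case: (boolP (x == 0)) => //= x0.
by rewrite -(prednK (ltnW Q_gt1)) exprS -[X in _ == X]mulr1 (inj_eq (mulfI x0)).
Qed.

(** The map y |-> y^d sends the N units to the at most N/d solutions of
    x^(N/d) = 1, with fibres of at most d elements; so all fibres over these
    solutions have exactly d elements. *)
Lemma count_power d (P : pred K) : (d %| N)%N ->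
  count (fun y => P (y ^+ d)) fix_units =
  (d * count (fun x => P x && (x ^+ (N %/ d) == 1%R)) fix_units)%N.
Proof.
move=> dN; have d0 : (0 < d)%N by apply: dvdn_gt0 dN.
pose G := [seq x <- fix_units | x ^+ (N %/ d) == 1].
pose f x := count (fun y => y ^+ d == x) fix_units.
have uG : uniq G by rewrite filter_uniq // uniq_fix_units.
have inG y : y \in fix_units -> y ^+ d \in G.
  rewrite mem_fix_units => /andP[y0 /eqP yN]; rewrite /G mem_filter mem_fix_units.
  by rewrite -exprM mulnC divnK // yN eqxx expf_neq0 //= exprAC yN expr1n eqxx.
have fib (A : pred K) : count (fun y => A (y ^+ d)) fix_units = (\sum_(x <- G | A x) f x)%N.
  rewrite -sum1_count big_mkcond /f.
  under [RHS]eq_bigr do rewrite -sum1_count.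
  rewrite (exchange_big_dep predT) //=; apply: eq_big_seq => y /inG yG.
  rewrite sum1_count (eq_count (a2 := fun x => A (y ^+ d) && (x == y ^+ d))) => [|x].
    case: (A _) => /=; last by rewrite count_pred0.
    by rewrite (count_uniq_mem _ uG) yG.
  by rewrite [y ^+ d == x]eq_sym; case: eqP => [->|]; rewrite ?andbT ?andbF.
have fd x : (f x <= d)%N.
  have P0 : 'X^d - x%:P != 0 :> {poly K}.
    by rewrite -size_poly_eq0 size_XnsubC.
  rewrite /f -size_filter -ltnS -(size_XnsubC x d0).
  apply: max_poly_roots => //; last by rewrite filter_uniq // uniq_fix_units.
  by apply/allP => y; rewrite mem_filter rootE !hornerE subr_eq0 => /andP[].
have sG : (size G <= N %/ d)%N.
  have Nd0 : (0 < N %/ d)%N by rewrite divn_gt0 // dvdn_leq.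
  have P0 : 'X^(N %/ d) - 1%:P != 0 :> {poly K}.
    by rewrite -size_poly_eq0 size_XnsubC.
  rewrite -ltnS -(size_XnsubC (1 : K) Nd0); apply: max_poly_roots => //.
  by apply/allP => y; rewrite mem_filter rootE !hornerE subr_eq0 => /andP[].
have fE x : x \in G -> f x = d.
  have sf : (\sum_(x <- G) f x)%N = N by rewrite -(fib predT) count_predT size_fix_units.
  have : (\sum_(x <- G) (d - f x) == 0)%N.
    have : (\sum_(x <- G) (d - f x) + \sum_(x <- G) f x <= N)%N.
      rewrite -big_split /=; under eq_bigr do rewrite subnK //.
      rewrite big_const_seq count_predT iter_addn_0 mulnC.
      by rewrite -[X in (_ <= X)%N](divnK dN) leq_mul2r sG orbT.
    by rewrite sf -[X in (_ <= X)%N]add0n leq_add2r leqn0.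
  rewrite sum_nat_seq_eq0 => /allP all0 /all0 /=; rewrite subn_eq0 => le.
  by apply/eqP; rewrite eqn_leq fd.
rewrite fib big_seq_cond (eq_bigr (fun=> d)) => [|x /andP[/fE]] //.
rewrite -big_seq_cond big_const_seq iter_addn_0 count_filter; congr (_ * _)%N.
Qed.

(** For d dividing N, the condition x^(N/d) = 1 says that the unit x is a d-th
    power. *)
Definition sifted ps d := count (fun x => [&& traces_ok x, x ^+ (N %/ d) == 1 &
   all (fun l => x ^+ (N %/ l) != 1) ps]) fix_units.

Let X : algC := Q%:R / (q ^ k)%:R.
Let err : algC := k%:R * sqrtC Q%:R.

Lemma sqrtQ_ge1 : 1 <= sqrtC (Q%:R : algC).
Proof.
rewrite -(ler_pXn2r (isT : 0 < 2)%N) ?nnegrE ?sqrtC_ge0 ?ler0n ?ler01 //.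
by rewrite sqrtCK expr1n ler1n ltnW.
Qed.

(** Discarding y = 0 costs at most 1 <= sqrt(Q), which the term - 1 in the Weil
    bound for degree d k makes up for. *)
Lemma sifted_nil d : (d %| N)%N -> `|(sifted [::] d)%:R - X / d%:R| <= err.
Proof.
move=> dN; have d0 : (0 < d)%N by apply: dvdn_gt0 dN.
have qk0 : 0 < (q ^ k)%:R :> algC by rewrite ltr0n expn_gt0 ltnW.
have d0' : 0 < d%:R :> algC by rewrite ltr0n.
have := count_power traces_ok dN.
set B := count _ _ => BE.
have -> : sifted [::] d = count (fun x => traces_ok x && (x ^+ (N %/ d) == 1)) fix_units.
  by apply: eq_count => x; rewrite /= andbT.
rewrite -(ler_pM2l d0') -{1}[d%:R]gtr0_norm // -normrM mulrBr -natrM -BE.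
rewrite mulrCA divff ?gt_eqF // mulr1.
rewrite -(ler_pM2l qk0) -{1}[(q ^ k)%:R]gtr0_norm // -normrM mulrBr -natrM.
rewrite /X mulrCA divff ?gt_eqF // mulr1.
pose B0 := count (fun y => traces_ok (y ^+ d) && (y == 0)) (fix_field K Q).
have B01 : (B0 <= 1)%N.
  rewrite (@leq_trans (count_mem 0 (fix_field K Q))) //.
    by apply: sub_count => y /= /andP[].
  by rewrite count_uniq_mem ?leq_b1 // QE (uniq_fix_field charp).
have BB : count (fun y => traces_ok (y ^+ d)) (fix_field K Q) = (B + B0)%N.
  rewrite /B /B0 /fix_units; elim: (fix_field K Q) => //= y ys ->.
  by case: (y == 0) => /=; rewrite ?andbT ?andbF /=; lia.
have := count_traces_power dN; rewrite BB mulnDr natrD => le.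
have -> : (q ^ k * B)%:R - Q%:R = (q ^ k * B)%:R + (q ^ k * B0)%:R - Q%:R - (q ^ k * B0)%:R :> algC.
  by ring.
rewrite (le_trans (ler_normB _ _)) //.
apply: (@le_trans _ _ ((q ^ k * (d * k - 1))%:R * sqrtC Q%:R + (q ^ k)%:R * sqrtC Q%:R)).
  apply: lerD => //; rewrite normr_nat natrM ler_wpM2l ?ler0n //.
  by rewrite (le_trans _ sqrtQ_ge1) // -[1]/(1%:R) ler_nat.
rewrite -mulrDl -natrD /err !mulrA -!natrM ler_wpM2r ?sqrtC_ge0 ?ler0n // ler_nat.
have dk : (0 < d * k)%N by rewrite muln_gt0 d0.
by rewrite -mulnSr subn1 prednK // mulnA.
Qed.

Lemma sifted_cons l ps d : (0 < d)%N -> (0 < l)%N -> coprime l d -> (d * l %| N)%N ->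
  (sifted (l :: ps) d + sifted ps (d * l) = sifted ps d)%N.
Proof.
move=> d0 l0 ld dN.
have key (x : K) : (x ^+ (N %/ (d * l)) == 1) = (x ^+ (N %/ d) == 1) && (x ^+ (N %/ l) == 1).
  move/dvdnP: dN => [M NE].
  have -> : (N %/ (d * l) = M)%N by rewrite NE mulnK // muln_gt0 d0.
  have -> : (N %/ d = M * l)%N by rewrite NE (mulnC d) mulnA mulnK.
  have -> : (N %/ l = M * d)%N by rewrite NE mulnA mulnK.
  apply/eqP/andP => [xM|[/eqP xl /eqP xd]]; first by rewrite !exprM xM !expr1n.
  by apply: (expf_coprime_eq1 ld); rewrite -?exprM.
rewrite /sifted -!sum1_count !(big_mkcond (fun _ => [&& _, _ & _])) /= -big_split.
apply: eq_bigr => x _ /=; rewrite key.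
by case: (traces_ok x) => //=; case: (_ == 1) => //=; case: (_ == 1); case: (all _ _).
Qed.

(** Each prime splits the count into two with the same error term, which
    therefore doubles. *)
Lemma sifted_bound ps d : (0 < d)%N -> uniq ps -> all prime ps -> all (coprime^~ d) ps ->
  (d * \prod_(l <- ps) l %| N)%N ->
  `|(sifted ps d)%:R - X / d%:R * \prod_(l <- ps) (1 - l%:R^-1)| <= (2 ^ size ps)%:R * err.
Proof.
elim: ps d => [|l ps IH] d d0.
  by rewrite !big_nil muln1 mulr1 mul1r => _ _ _; apply: sifted_nil.
rewrite /= !big_cons => /andP[lps ups] /andP[pl pps] /andP[ld cps] dN.
have l0 := prime_gt0 pl.
have dlN : (d * l * \prod_(j <- ps) j %| N)%N by rewrite -mulnA.
have dN' : (d * \prod_(j <- ps) j %| N)%N.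
  by apply: dvdn_trans dlN; rewrite -mulnA [(l * _)%N]mulnC mulnA dvdn_mulr.
have IH1 := IH d d0 ups pps cps dN'.
have IH2 : `|(sifted ps (d * l))%:R - X / (d * l)%:R * \prod_(l <- ps) (1 - l%:R^-1)|
    <= (2 ^ size ps)%:R * err.
  apply: IH => //; first by rewrite muln_gt0 d0.
  apply/allP => j jps /=; rewrite coprimeMr (allP cps) //=.
  have pj : prime j by apply: (allP pps).
  rewrite prime_coprime // dvdn_prime2 //.
  by apply: contraNneq lps => <-.
have := sifted_cons ps d0 l0 ld (dvdn_trans (dvdn_mulr _ (dvdnn _)) dlN).
move/(congr1 (fun m : nat => m%:R : algC)); rewrite natrD => E.
have l0' : l%:R != 0 :> algC by rewrite pnatr_eq0 -lt0n.
have d0' : d%:R != 0 :> algC by rewrite pnatr_eq0 -lt0n.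
move: IH1 IH2; set Pi := \prod_(j <- ps) (1 - j%:R^-1) => IH1 IH2.
have -> : (sifted (l :: ps) d)%:R - X / d%:R * ((1 - l%:R^-1) * Pi) =
  ((sifted ps d)%:R - X / d%:R * Pi) - ((sifted ps (d * l))%:R - X / (d * l)%:R * Pi).
  rewrite -E natrM; field; rewrite l0' d0' //.
rewrite (le_trans (ler_normB _ _)) //.
have -> : (2 ^ (size ps).+1)%:R * err = (2 ^ size ps)%:R * err + (2 ^ size ps)%:R * err.
  by rewrite expnS natrM; ring.
exact: lerD.
Qed.

(** The product of the 1 - 1/l is at least 2^(- omega), so the main term in
    [sifted_bound] is at least Q / (q^k 2^omega), to compare with
    2^omega k sqrt(Q). *)
Theorem exists_primitive_traces :
  ((4 ^ size (primes N) * k * q ^ k) ^ 2 < Q)%N ->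
  exists x, [/\ N.-primitive_root x & traces_ok x].
Proof.
move=> big.
have dN : (1 * \prod_(l <- primes N) l %| N)%N by rewrite mul1n prod_primes_dvd.
have := sifted_bound (isT : 0 < 1)%N (primes_uniq N) _ _ dN.
move=> /(_ _ _); rewrite invr1 mulr1.
have pp : all prime (primes N) by apply/allP => l; rewrite mem_primes => /and3P[].
have cp : all (coprime^~ 1%N) (primes N) by apply/allP => l _; rewrite /= coprimen1.
move=> /(_ pp cp); set w := size _ => bnd.
have : (0 < sifted (primes N) 1)%N.
  rewrite lt0n; apply/eqP => s0; move: bnd; rewrite s0 sub0r normrN.
  have qk0 : 0 < (q ^ k)%:R :> algC by rewrite ltr0n expn_gt0 ltnW.
  have X0 : 0 < X by rewrite divr_gt0 // ltr0n ltnW.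
  have Pi_ge := prod_prime_factor_ge pp; rewrite -/w in Pi_ge.
  rewrite ger0_norm; last by rewrite mulr_ge0 ?(ltW X0) // (le_trans _ Pi_ge) // invr_ge0 ler0n.
  move/(le_trans (ler_wpM2l (ltW X0) Pi_ge)); apply/negP.
  have sM : (4 ^ w * k * q ^ k)%:R < sqrtC Q%:R :> algC.
    rewrite -(ltr_pXn2r (isT : 0 < 2)%N) ?nnegrE ?sqrtC_ge0 ?ler0n //.
    by rewrite sqrtCK -natrX ltr_nat.
  have w0 : 0 < (2 ^ w)%:R :> algC by rewrite ltr0n expn_gt0.
  have s0' : 0 < sqrtC Q%:R :> algC by apply: lt_le_trans sqrtQ_ge1.
  suff lt : (2 ^ w)%:R * err < X * (2 ^ w)%:R^-1 by rewrite lt_geF.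
  rewrite ltr_pdivlMr // /X ltr_pdivlMr //.
  have -> : Q%:R = sqrtC Q%:R * sqrtC Q%:R :> algC by rewrite -expr2 sqrtCK.
  have -> : (2 ^ w)%:R * err * (2 ^ w)%:R * (q ^ k)%:R =
            (4 ^ w * k * q ^ k)%:R * sqrtC Q%:R.
    by rewrite /err (expnMn 2 2 w) !natrM; ring.
  by rewrite ltr_pM2r.
rewrite -has_count => /hasP[x]; rewrite mem_fix_units => /andP[x0 /eqP xN].
case/and3P=> tx _ /allP xl; exists x; split=> //.
have [m mprim mN] := prim_order_exists N_gt0 xN.
have [<-//|mneN] := eqVneq m N.
have m0 : (0 < m)%N by apply: dvdn_gt0 mN.
have : (1 < N %/ m)%N by rewrite ltn_divRL // mul1n ltn_neqAle mneN dvdn_leq.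
move=> /pdivP[l pl lNm].
have lN : (l %| N)%N by apply: dvdn_trans lNm (dvdn_div mN).
have := xl l; rewrite mem_primes pl N_gt0 lN => /(_ isT) /negP[].
by rewrite -(prim_order_dvd mprim) dvdn_divRL // mulnC -dvdn_divRL.
Qed.

End PrescribedTraces.

(** * Coefficients, thresholds and the theorem *)

(** The traces to prescribe are the power sums of the roots of
    X^n + c_1 X^(n-1) + ... + c_k X^(n-k): two monic polynomials of degree n with
    the same first k < p power sums have the same first k coefficients. *)
Lemma traces_of_coeffs (K : closedFieldType) p (charp : p \in [pchar K]) R n
  (F : finFieldType) (iota_F : {rmorphism F -> K}) k (c : 'I_k -> F) :
  (0 < R)%N -> #|F| = (p ^ R)%N -> (k < n)%N -> (k < p)%N ->
  exists2 u : 'I_k -> K, forall j, u j \in fix_field K (p ^ R) &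
   forall x (f : {poly F}), map_poly iota_F f = orb_poly p R n x ->
     traces_ok p R n u x -> forall j : 'I_k, f`_(n - j.+1) = c j.
Proof.
move=> R0 cardF kn kp; set q := (p ^ R)%N.
pose f0 : {poly F} := 'X^n + \sum_(j < k) c j *: 'X^(n - j.+1).
have lt : (size (\sum_(j < k) c j *: 'X^(n - j.+1) : {poly F})%R < n.+1)%N.
  rewrite ltnS (leq_trans (size_sum _ _ _)) //; apply/bigmax_leqP => j _.
  rewrite (leq_trans (size_scale_leq _ _)) // size_polyXn.
  by have := ltn_ord j; lia.
have s0 : size f0 = n.+1 by rewrite size_polyDl size_polyXn.
have m0 : f0 \is monic by rewrite qualifE /= lead_coefDl ?lead_coefXn ?size_polyXn.
have f0c (j : 'I_k) : f0`_(n - j.+1) = c j.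
  have jk := ltn_ord j.
  rewrite coefD coefXn (_ : (n - j.+1 == n)%N = false) ?add0r; last by lia.
  rewrite coef_sum (bigD1 j) //= coefZ coefXn eqxx mulr1 big1 ?addr0 // => i ij.
  rewrite coefZ coefXn (_ : (_ == _) = false) ?mulr0 //.
  move: ij; rewrite -val_eqE /= => ij; have := ltn_ord i.
  by move: ij; move: (i : nat) => i' ij ik; apply/eqP; move/eqP: ij; lia.
pose g0 := map_poly iota_F f0.
have g1 : g0 \is monic by rewrite map_monic.
have sg : size (rts g0) = n.
  by apply: succn_inj; rewrite -size_rts // size_map_poly.
have q1 : (1 < q)%N by apply: (ltn_expp charp).
have rg : rational p R g0.
  apply/(rationalP charp) => i; rewrite coef_map.
  have := mem_iota_fix charp R0 iota_F cardF f0`_i.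
  by rewrite mem_fix_field // => /eqP.
exists (fun j => psum (rts g0) j.+1).
  move=> j; rewrite mem_fix_field // /psum (frob_sum charp).
  under eq_bigr do rewrite exprAC -/(frob p R _).
  rewrite -(big_map (frob p R) predT (fun x => x ^+ j.+1)).
  by rewrite (perm_big _ (perm_frob_rts charp g1 rg)).
move=> x f fP /forallP tx j; apply: (fmorph_inj iota_F).
rewrite -coef_map fP /orb_poly -f0c -coef_map -/g0 (rtsE g1).
have jn : (j.+1 <= n)%N by rewrite (leq_trans (ltn_ord j)) // ltnW.
have -> : (\prod_(y <- orb p R n x) ('X - y%:P))`_(n - j.+1) =
  (revprod (orb p R n x))`_j.+1 by rewrite -coef_revprod size_traject.
have -> : (\prod_(y <- rts g0) ('X - y%:P))`_(n - j.+1) =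
  (revprod (rts g0))`_j.+1 by rewrite -coef_revprod sg.
apply: (@newton_coef_inj _ _ _ k) => // r /andP[r0 rk].
  by rewrite -(dvdn_pcharf charp) gtnNdvd // (leq_ltn_trans rk).
have rk' : (r.-1 < k)%N by rewrite prednK.
have /eqP := tx (Ordinal rk'); rewrite /= prednK // => <-.
rewrite /psum /rel_trace /orb; elim: (n) => [|m IH]; first by rewrite big_nil big_ord0.
rewrite trajectSr -cats1 big_cat big_seq1 IH big_ord_recr /=.
by rewrite (iter_frob p R) exprAC.
Qed.

(** Compare the t-th powers: (2^omega)^(4t) is at most C^4 q^(4n), k^(2t) is less
    than q^(2t) and C^4 <= q <= q^n. *)
Lemma threshold_bound t n k q N : (0 < t)%N -> (0 < n)%N -> (0 < k)%N -> (k < q)%N ->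
  N = (q ^ n).-1 -> (2 * k * t + 2 * t + 5 * n <= n * t)%N ->
  ((2 ^ (t * 2 ^ t)) ^ 4 <= q)%N ->
  ((4 ^ size (primes N) * k * q ^ k) ^ 2 < q ^ n)%N.
Proof.
move=> t0 n0 k0 kq NE le Cq.
have q0 : (0 < q)%N by apply: leq_ltn_trans kq.
have q1 : (1 < q)%N by apply: leq_ltn_trans kq.
have Q1 : (1 < q ^ n)%N by rewrite -(expn0 q) ltn_exp2l.
have N0 : (0 < N)%N by rewrite NE -subn1 subn_gt0.
have NQ : (N <= q ^ n)%N by rewrite NE leq_pred.
set w := size (primes N); set C := (2 ^ (t * 2 ^ t))%N in Cq.
have wb : ((2 ^ w) ^ t <= C * q ^ n)%N.
  by apply: leq_trans (exp2_omega_bound t N0) _; rewrite leq_mul2l NQ orbT.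
rewrite -(ltn_exp2r _ _ t0).
have -> : (((4 ^ w * k * q ^ k) ^ 2) ^ t = ((2 ^ w) ^ t) ^ 4 * (k ^ (2 * t) * q ^ (2 * k * t)))%N.
  have -> : (4 ^ w = 2 ^ (2 * w))%N by rewrite expnM.
  rewrite !expnMn -!expnM [RHS]mulnA.
  by rewrite -!expnD; congr (_ ^ _ * _ ^ _ * _ ^ _)%N; lia.
apply: (@leq_ltn_trans ((C * q ^ n) ^ 4 * (k ^ (2 * t) * q ^ (2 * k * t)))%N).
  by rewrite leq_mul2r leq_exp2r // wb orbT.
apply: (@leq_trans (q * q ^ (4 * n) * (q ^ (2 * t) * q ^ (2 * k * t)))%N).
  rewrite expnMn -expnM (mulnC n).
  apply: (@leq_trans ((C ^ 4 * q ^ (4 * n)) * (q ^ (2 * t) * q ^ (2 * k * t)))%N).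
    rewrite ltn_pmul2l ?muln_gt0 ?expn_gt0 ?q0 ?orbT //.
    by rewrite ltn_pmul2r ?expn_gt0 ?q0 // ltn_exp2r // muln_gt0.
  by rewrite leq_mul2r leq_mul2r Cq !orbT.
by rewrite -expnS -!expnD -expnM leq_exp2l //; lia.
Qed.

Theorem theorem1 (R : realType) (eps : R) (eps_gt0 : 0 < eps) :
  exists q_eps : R,
    forall n k : nat, (1 <= n)%N -> (1 <= k)%N ->
      k%:R < n%:R * (2^-1 - eps) - 1 ->
    forall (p v : nat) (F : finFieldType),
      prime p -> (1 <= v)%N -> #|F| = (p ^ v)%N -> odd #|F| ->
      q_eps <= #|F|%:R -> (k < p)%N ->
    forall c : 'I_k -> F,
    exists f : {poly F},
      [/\ primitive_polynomial f,
          size f = n.+1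
        & forall i : 'I_k, f`_(n - i.+1) = c i].
Proof.
(* Then 2 eps t >= 5, which is what turns the hypothesis on k into the
   inequality of exponents in threshold_bound. *)
pose t := (Num.bound (5 / (2 * eps))).+1.
exists ((2 ^ (t * 2 ^ t)) ^ 4)%:R => n k n0 k0 kn p v F p_pr v0 cardF _.
rewrite ler_nat => Cq kp c.
have t_eps : 5 <= 2 * eps * t%:R.
  have e2 : 0 < 2 * eps by rewrite mulr_gt0.
  rewrite mulrC -ler_pdivrMr // (le_trans (ltW (archi_boundP _))) //.
    by rewrite divr_ge0 // ltW.
  by rewrite ler_nat.
have n0' : 0 < n%:R :> R by rewrite ltr0n.
have t0' : 0 < t%:R :> R by rewrite ltr0n.
have le : (2 * k * t + 2 * t + 5 * n <= n * t)%N.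
  rewrite -(ler_nat R) !natrD !natrM.
  have h1 : 5 * n%:R <= 2 * eps * t%:R * n%:R by rewrite ler_pM2r.
  have h2 : k%:R * t%:R < (n%:R * (2^-1 - eps) - 1) * t%:R by rewrite ltr_pM2r.
  lra.
have kn' : (k < n)%N by move: le; rewrite /t; nia.
have charF := card_finPcharP cardF p_pr.
have [K [iota_F _]] := countable_algebraic_closure F.
have charK : p \in [pchar K] by apply: rmorph_pchar charF.
have [z prim_z] := C_prim_root_exists (prime_gt0 p_pr).
have [u uE ucoef] := traces_of_coeffs charK iota_F c v0 cardF kn' kp.
have [|x [xprim xtr]] :=
  exists_primitive_traces charK v0 n0 iota_F cardF prim_z k0 kp uE.
  apply: (threshold_bound (t := t)) => //; last by rewrite -cardF.
  rewrite -cardF (leq_trans kp) // cardF -{1}[p]expn1 leq_pexp2l // prime_gt0 //.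
have [f [fprim sf fE]] :=
  primitive_minpoly charK v0 n0 iota_F cardF xprim.
by exists f; split=> //; apply: ucoef fE xtr.
Qed.
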